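(* Let $0<d<\pi/2$ and $\psi(\zeta)=\sinh\left(\frac{\pi}{2}\sinh\zeta\right)$. Assume that $f$ is analytic in $\psi(\mathscr{D}_d)$ and that there exist positive constants $K,\alpha,\beta$ such that $|f(z)|\le K|E_1(z;\alpha)|$ for all $z\in\psi(\mathscr{D}_d^{-})$ and $|f(z)|\le K|E_1(z;\beta)|$ for all $z\in\psi(\mathscr{D}_d^{+})$. Let $\mu=\min\{\alpha,\beta\}$ and $\nu=\max\{\alpha,\beta\}$. For a positive integer $n$ let $h=\frac{\log(4dn/\mu)}{n}$, and let $M,N$ be defined by $M=n,\ N=n-\lfloor\log(\beta/\alpha)/h\rfloor$ if $\mu=\alpha$, and $N=n,\ M=n-\lfloor\log(\alpha/\beta)/h\rfloor$ if $\mu=\beta$. Let $n$ be sufficiently large that $n\ge(\nu\mathrm{e})/(4d)$. Then $$\sup_{t\in(-\infty,\infty)}\left|f(t)-\sum_{k=-M}^{N}f(\psi(kh))\,S(k,h)(\psi^{-1}(t))\right|\le C_1\,\mathrm{e}^{-\pi dn/\log(4dn/\mu)},$$ where $C_1$ is the constant independent of $n$ given by $$C_1=\frac{2^{\nu+1}K}{\pi d\mu}\left\{\frac{4}{\pi(1-\mathrm{e}^{-\pi\mu\mathrm{e}/2})\{\cos(\frac{\pi}{2}\sin d)\}^{\nu}\cos d}+\mu\,\mathrm{e}^{\pi\nu/4}\right\}.$$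
   Context: For $d>0$: $\mathscr{D}_d=\{\zeta\in\mathbb{C}:|\operatorname{Im}\zeta|<d\}$, $\mathscr{D}_d^{-}=\{\zeta\in\mathscr{D}_d:\operatorname{Re}\zeta<0\}$, $\mathscr{D}_d^{+}=\{\zeta\in\mathscr{D}_d:\operatorname{Re}\zeta\ge0\}$. The Sinc function is $S(k,h)(x)=\frac{\sin[\pi(x/h-k)]}{\pi(x/h-k)}$ (with value $1$ at $x=kh$). $|E_1(z;\gamma)|=|1+z^2|^{-\gamma/2}$, where $E_1(z;\gamma)=(1+z^2)^{-\gamma/2}$. $\psi^{-1}$ is the inverse of $\psi:\mathbb{R}\to\mathbb{R}$. Convention: $\psi$ is not injective on $\mathscr{D}_d$ and $\psi(\mathscr{D}_d)$ is regarded as an (infinitely sheeted) Riemann surface. Thus ''$f$ is analytic in $\psi(\mathscr{D}_d)$'' means that $F(\zeta)=f(\psi(\zeta))$ is an analytic function on $\mathscr{D}_d$ (with $f(t)=F(\psi^{-1}(t))$ for real $t$), and a bound on $|f(z)|$ for all $z\in\psi(A)$, $A\subset\mathscr{D}_d$, means the bound on $|F(\zeta)|$ with $z=\psi(\zeta)$, for all $\zeta\in A$. *)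

(* Defs.v *)
From Stdlib Require Import Reals ZArith List.
From Coquelicot Require Import Coquelicot.
Open Scope R_scope.

Definition strip (d : R) (zeta : C) : Prop := Rabs (Im zeta) < d.
Definition strip_minus (d : R) (zeta : C) : Prop := strip d zeta /\ Re zeta < 0.
Definition strip_plus (d : R) (zeta : C) : Prop := strip d zeta /\ 0 <= Re zeta.

(* Complex differentiability at every point of [D]; meant for open [D]. *)
Definition analytic_on (D : C -> Prop) (F : C -> C) : Prop :=
  forall zeta : C, D zeta -> ex_derive (K := C_AbsRing) (V := C_NormedModule) F zeta.

Definition Cexp (z : C) : C := (exp (Re z) * cos (Im z), exp (Re z) * sin (Im z)).
Definition Csinh (z : C) : C := ((Cexp z - Cexp (- z)) / 2)%C.

Definition psiC (zeta : C) : C := Csinh (RtoC (PI / 2) * Csinh zeta)%C.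
Definition psi (x : R) : R := sinh (PI / 2 * sinh x).
Definition psi_inv (t : R) : R := arcsinh (2 / PI * arcsinh t).

Lemma Csinh_real (x : R) : Csinh (RtoC x) = RtoC (sinh x).
Proof.
unfold Csinh, Cexp, sinh, RtoC, Cdiv, Cminus, Cplus, Copp, Cinv, Cmult; simpl.
rewrite Ropp_0, cos_0, sin_0; f_equal; field.
Qed.

Lemma psiC_real (x : R) : psiC (RtoC x) = RtoC (psi x).
Proof.
unfold psiC, psi; rewrite Csinh_real, <- RtoC_mult; apply Csinh_real.
Qed.

Lemma psi_inv_psi (x : R) : psi_inv (psi x) = x.
Proof.
unfold psi_inv, psi; rewrite arcsinh_sinh.
replace (2 / PI * (PI / 2 * sinh x)) with (sinh x) by (field; apply PI_neq0).
apply arcsinh_sinh.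
Qed.

Lemma psi_psi_inv (t : R) : psi (psi_inv t) = t.
Proof.
unfold psi_inv, psi; rewrite sinh_arcsinh.
replace (PI / 2 * (2 / PI * arcsinh t)) with (arcsinh t) by (field; apply PI_neq0).
apply sinh_arcsinh.
Qed.

(* A function f on the Riemann surface psi(D_d) is given by its lift
   F(zeta) = f(psi(zeta)) to D_d; this is f on the real line. *)
Definition on_real_line (F : C -> C) (t : R) : C := F (RtoC (psi_inv t)).

(* |E_1(z; gamma)|.  [Rpower] is meaningful only for a positive base; here
   1 + psi(zeta)^2 = cosh(pi/2 sinh zeta)^2, which has no zero for
   |Im zeta| < pi/2. *)
Definition abs_E1 (gamma : R) (z : C) : R := Rpower (Cmod (1 + z * z)%C) (- gamma / 2).

Definition sinc (k : Z) (h x : R) : R :=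
  if Req_EM_T x (IZR k * h) then 1
  else sin (PI * (x / h - IZR k)) / (PI * (x / h - IZR k)).

(* g a + g (a+1) + ... + g b, the empty sum if b < a. *)
Definition sum_Z (a b : Z) (g : Z -> C) : C :=
  fold_right Cplus (RtoC 0)
    (map (fun i : nat => g (a + Z.of_nat i)%Z) (seq 0 (Z.to_nat (b - a + 1)))).

Definition const_C1 (K d mu nu : R) : R :=
  Rpower 2 (nu + 1) * K / (PI * d * mu) *
  (4 / (PI * (1 - exp (- (PI * mu * exp 1 / 2)))
        * Rpower (cos (PI / 2 * sin d)) nu * cos d)
   + mu * exp (PI * nu / 4)).

(* Main.v *)
Require Import Defs.
From Stdlib Require Import Reals ZArith Lra Lia List.
From Coquelicot Require Import Coquelicot.
Open Scope R_scope.

(* On a rectangle around [-(L+1/2)h, (L+1/2)h] of half-height s < d, the residue theorem for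
   z |-> F z / ((z - x) sin (pi z / h)) expresses F x - sum_k F(kh) S(k,h)(x) as
   sin (pi x / h) / (2 pi i) times the contour integral.  The vertical sides vanish as L tends to
   infinity.  On the horizontal ones |sin| >= sinh (pi s / h), and the key inequality
   |cosh ((pi/2) sinh (x + i y))| >= cosh ((pi/2) sinh x cos y) cos ((pi/2) sin y)
   bounds F by a double exponential, whose integral is explicit once it is multiplied by
   cosh >= 1; then s tends to d.  The tails of the sinc series are telescoped against
   exp (- c sinh (k h)), and the choices of h, M and N make alpha e^(Mh) and beta e^(Nh) at least
   4 d n, which balances all the errors. *)

(** The bounds on [F] and its differentiability hold only in the open strip, so every contour stays
    at height [s < d] and the estimates are uniform in [s]. Since [analytic_on] gives a derivative
    at each point and says nothing of its continuity, Cauchy's theorem is obtained by Goursat's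
    bisection. The obstacle to decay is that the imaginary part (pi/2) cosh x sin y of the inner
    argument is unbounded: in |cosh (a + ib)|^2 = cosh a ^ 2 - sin b ^ 2 the sine oscillates, and
    only the growth of cosh a can compensate. The key inequality is an equality at x = 0, which is
    where the factor cos((pi/2) sin d) comes from. In [const_C1], the power of 2 stems from cosh a
    >= e^|a| / 2; 1 - exp(- pi mu e / 2) from sinh(pi d / h) together with ln z <= z / e; and exp(pi
    nu / 4) from the small half of sinh X = (e^X - e^(-X)) / 2 at the ends of the sum. The tails
    carry the factor exp(- pi d n), so the contour integral, with exp(- pi d / h), determines the
    rate. *)

Notation Cderivable f z :=
  (ex_derive (K := C_AbsRing) (V := AbsRing_NormedModule C_AbsRing) f z).
Notation Cis_derive f z l :=
  (is_derive (K := C_AbsRing) (V := AbsRing_NormedModule C_AbsRing) f z l).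
Notation Ccontinuous f z :=
  (continuous (T := AbsRing_UniformSpace C_AbsRing) (U := AbsRing_UniformSpace C_AbsRing) f z).

(** * Complex differentiability and continuity in epsilon-delta form *)

Lemma Cderivable_of_ex_derive (F : C -> C) (z : C) :
  ex_derive (K := C_AbsRing) (V := C_NormedModule) F z -> Cderivable F z.
Proof.
intros [l [_ H]]; exists l; split; [apply is_linear_scal_l | exact H].
Qed.

Lemma Cis_derive_eps (f : C -> C) (z l : C) :
  Cis_derive f z l <->
  forall eps, 0 < eps -> exists delta, 0 < delta /\ forall w, Cmod (w - z) < delta ->
    Cmod (f w - f z - (w - z) * l)%C <= eps * Cmod (w - z).
Proof.
split.
- intros [_ H] eps Heps.
  destruct (H z (fun P H => H) (mkposreal eps Heps)) as [delta Hd].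
  exists delta; split; [apply cond_pos | intros w Hw; exact (Hd w Hw)].
- intros H; split; [apply is_linear_scal_l |].
  (* The differential quantifies over every limit [z'] of the filter [locally z]; uniqueness of
     limits leaves only [z] itself. *)
  intros z' Hz'.
  assert (E : z' = z) by (apply sym_eq, (is_filter_lim_locally_unique (V := AbsRing_NormedModule C_AbsRing) z z' Hz')).
  subst z'; intros eps.
  destruct (H eps (cond_pos eps)) as [delta [Hd Hw]].
  exists (mkposreal delta Hd); intros w Hw'; exact (Hw w Hw').
Qed.

Lemma Ccontinuous_eps (f : C -> C) (z : C) :
  Ccontinuous f z <->
  forall eps, 0 < eps -> exists delta, 0 < delta /\ forall w, Cmod (w - z) < delta ->
    Cmod (f w - f z) < eps.
Proof.
split.
- intros H eps Heps.
  destruct (proj1 (filterlim_locally _ _) H (mkposreal eps Heps)) as [delta Hd].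
  exists delta; split; [apply cond_pos | intros w Hw; exact (Hd w Hw)].
- intros H; apply filterlim_locally; intros eps.
  destruct (H eps (cond_pos eps)) as [delta [Hd Hw]].
  exists (mkposreal delta Hd); intros w Hw'; exact (Hw w Hw').
Qed.

Lemma Cderivable_continuous (f : C -> C) (z : C) : Cderivable f z -> Ccontinuous f z.
Proof. exact (ex_derive_continuous (K := C_AbsRing) (V := AbsRing_NormedModule C_AbsRing) f z). Qed.

Lemma Cderivable_mult (f g : C -> C) (z : C) :
  Cderivable f z -> Cderivable g z -> Cderivable (fun w => f w * g w)%C z.
Proof.
intros [lf Hf] [lg Hg]; eexists.
apply (is_derive_mult (K := C_AbsRing) f g z lf lg Hf Hg Cmult_comm).
Qed.

Lemma Cmod_ge_1_sub (z w : C) : Cmod z - Cmod (w - z) <= Cmod w.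
Proof.
replace z with (w + - (w - z))%C at 1 by ring.
pose proof (Cmod_triangle w (- (w - z))); rewrite Cmod_opp in H; lra.
Qed.

Lemma Cis_derive_inv (z : C) : z <> 0 -> Cis_derive Cinv z (- / (z * z))%C.
Proof.
intros Hz; apply Cis_derive_eps; intros eps Heps.
assert (Hm : 0 < Cmod z) by (apply Cmod_gt_0; exact Hz).
assert (Hm3 : 0 < Cmod z ^ 3) by (apply pow_lt; exact Hm).
(* The remainder is (w - z)^2 / (w z^2). The first bound gives |w| >= |z| / 2, and the second then
   makes |w - z| / (|w| |z|^2) at most [eps]. *)
exists (Rmin (Cmod z / 2) (eps * (Cmod z ^ 3) / 2)); split.
{ apply Rmin_glb_lt; [lra | nra]. }
intros w Hw.
assert (H1 : Cmod (w - z) < Cmod z / 2) by (eapply Rlt_le_trans; [exact Hw | apply Rmin_l]).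
assert (H2 : Cmod (w - z) < eps * (Cmod z ^ 3) / 2)
  by (eapply Rlt_le_trans; [exact Hw | apply Rmin_r]).
assert (H3 : Cmod z / 2 <= Cmod w) by (pose proof (Cmod_ge_1_sub z w); lra).
assert (Hw0 : w <> 0) by (apply Cmod_gt_0; lra).
replace (/ w - / z - (w - z) * - / (z * z))%C
  with ((w - z) * ((w - z) / (w * (z * z))))%C by (field; split; assumption).
rewrite Cmod_mult, Rmult_comm; apply Rmult_le_compat_r; [apply Cmod_ge_0 |].
rewrite Cmod_div, !Cmod_mult by (repeat apply Cmult_neq_0; assumption).
apply Rle_div_l; [apply Rmult_lt_0_compat; nra |].
assert (H4 : 0 <= (eps * (Cmod z * Cmod z)) * (Cmod w - Cmod z / 2))
  by (apply Rmult_le_pos; [apply Rmult_le_pos; nra | lra]).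
nra.
Qed.

Lemma Cderivable_inv (f : C -> C) (z : C) :
  f z <> 0 -> Cderivable f z -> Cderivable (fun w => / f w)%C z.
Proof.
intros Hz [l Hl]; eexists.
apply (is_derive_comp (K := C_AbsRing) (V := AbsRing_NormedModule C_AbsRing) Cinv f z).
- apply Cis_derive_inv; exact Hz.
- exact Hl.
Qed.

(** * Contour integrals over rectangles *)

Notation CInt := (RInt (V := C_R_CompleteNormedModule)).
Notation ex_CInt := (ex_RInt (V := C_R_CompleteNormedModule)).

Lemma continuous_hline (G : C -> C) (x y : R) :
  Ccontinuous G (x, y) -> continuous (U := C_R_CompleteNormedModule) (fun t : R => G (t, y)) x.
Proof.
intros H; apply filterlim_locally; intros eps.
destruct (proj1 (Ccontinuous_eps G (x, y)) H eps (cond_pos eps)) as [delta [Hd Hw]].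
exists (mkposreal delta Hd); intros t Ht.
apply (C_NormedModule_mixin_compat1 (G (x, y)) (G (t, y)) eps), Hw.
replace ((t, y) - (x, y))%C with (RtoC (t - x))
  by (unfold Cminus, Cplus, Copp, RtoC; simpl; f_equal; ring).
rewrite Cmod_R; exact Ht.
Qed.

Lemma continuous_vline (G : C -> C) (x y : R) :
  Ccontinuous G (x, y) -> continuous (U := C_R_CompleteNormedModule) (fun t : R => G (x, t)) y.
Proof.
intros H; apply filterlim_locally; intros eps.
destruct (proj1 (Ccontinuous_eps G (x, y)) H eps (cond_pos eps)) as [delta [Hd Hw]].
exists (mkposreal delta Hd); intros t Ht.
apply (C_NormedModule_mixin_compat1 (G (x, y)) (G (x, t)) eps), Hw.
replace ((x, t) - (x, y))%C with (Ci * RtoC (t - y))%C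
  by (unfold Cminus, Cplus, Copp, RtoC, Ci, Cmult; simpl; f_equal; ring).
rewrite Cmod_mult, Cmod_Ci, Cmod_R, Rmult_1_l; exact Ht.
Qed.

Lemma ex_CInt_hline (G : C -> C) (a b y : R) : a <= b ->
  (forall x, a <= x <= b -> Ccontinuous G (x, y)) -> ex_CInt (fun x => G (x, y)) a b.
Proof.
intros Hab H; apply ex_RInt_continuous; intros x Hx.
rewrite Rmin_left, Rmax_right in Hx by exact Hab.
apply continuous_hline, H, Hx.
Qed.

Lemma ex_CInt_vline (G : C -> C) (x c e : R) : c <= e ->
  (forall y, c <= y <= e -> Ccontinuous G (x, y)) -> ex_CInt (fun y => G (x, y)) c e.
Proof.
intros Hab H; apply ex_RInt_continuous; intros y Hy.
rewrite Rmin_left, Rmax_right in Hy by exact Hab.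
apply continuous_vline, H, Hy.
Qed.

Lemma CInt_Chasles (f : R -> C) (a b c : R) :
  ex_CInt f a b -> ex_CInt f b c -> CInt f a c = (CInt f a b + CInt f b c)%C.
Proof. intros H1 H2; symmetry; exact (RInt_Chasles (V := C_R_CompleteNormedModule) f a b c H1 H2). Qed.

Lemma CInt_minus (f g : R -> C) (a b : R) :
  ex_CInt f a b -> ex_CInt g a b ->
  CInt (fun t => f t - g t)%C a b = (CInt f a b - CInt g a b)%C.
Proof. exact (RInt_minus (V := C_R_CompleteNormedModule) f g a b). Qed.

Lemma Cmod_CInt_le (f : R -> C) (g : R -> R) (a b l : R) : a <= b ->
  (forall x, a <= x <= b -> Cmod (f x) <= g x) ->
  ex_CInt f a b -> is_RInt g a b l -> Cmod (CInt f a b) <= l.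
Proof.
intros Hab H Hf Hg; rewrite Cmod_norm.
apply (norm_RInt_le (V := C_R_NormedModule) f g a b); [exact Hab | | | exact Hg].
- intros x Hx; pose proof (H x Hx); rewrite Cmod_norm in H0; exact H0.
- apply (RInt_correct (V := C_R_CompleteNormedModule)); exact Hf.
Qed.

Lemma Cmod_CInt_le_const (f : R -> C) (a b B : R) : a <= b ->
  (forall x, a <= x <= b -> Cmod (f x) <= B) ->
  ex_CInt f a b -> Cmod (CInt f a b) <= (b - a) * B.
Proof.
intros Hab H Hf; apply (Cmod_CInt_le f (fun _ => B) a b); try assumption.
apply (is_RInt_const (V := R_NormedModule)).
Qed.

(* Counterclockwise integral of [G] along the boundary of [a,b] x [c,e]. *)
Definition rect_int (G : C -> C) (a b c e : R) : C :=
  (CInt (fun x => G (x, c)) a b + Ci * CInt (fun y => G (b, y)) c e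
   - CInt (fun x => G (x, e)) a b - Ci * CInt (fun y => G (a, y)) c e)%C.

(** Restricted to the four sides because the integrands compared near a residue have a pole inside
    the rectangle. *)
Definition continuous_on_boundary (G : C -> C) (a b c e : R) : Prop :=
  forall x y, a <= x <= b -> c <= y <= e -> x = a \/ x = b \/ y = c \/ y = e ->
  Ccontinuous G (x, y).

Definition continuous_on_rect (G : C -> C) (a b c e : R) : Prop :=
  forall x y, a <= x <= b -> c <= y <= e -> Ccontinuous G (x, y).

Lemma rect_int_hsplit (G : C -> C) (a m b c e : R) : a <= m <= b ->
  (forall x, a <= x <= b -> Ccontinuous G (x, c) /\ Ccontinuous G (x, e)) ->
  rect_int G a b c e = (rect_int G a m c e + rect_int G m b c e)%C.
Proof.
intros Hm H; unfold rect_int.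
rewrite (CInt_Chasles (fun x => G (x, c)) a m b), (CInt_Chasles (fun x => G (x, e)) a m b);
  [ring | ..]; apply ex_CInt_hline; try lra; intros x Hx; apply H; lra.
Qed.

Lemma rect_int_vsplit (G : C -> C) (a b c m e : R) : c <= m <= e ->
  (forall y, c <= y <= e -> Ccontinuous G (a, y) /\ Ccontinuous G (b, y)) ->
  rect_int G a b c e = (rect_int G a b c m + rect_int G a b m e)%C.
Proof.
intros Hm H; unfold rect_int.
rewrite (CInt_Chasles (fun y => G (a, y)) c m e), (CInt_Chasles (fun y => G (b, y)) c m e);
  [ring | ..]; apply ex_CInt_vline; try lra; intros x Hx; apply H; lra.
Qed.

Lemma Cmod_rect_int_le (G : C -> C) (a b c e H1 H2 V1 V2 : R) :
  Cmod (CInt (fun x => G (x, c)) a b) <= H1 -> Cmod (CInt (fun x => G (x, e)) a b) <= H2 ->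
  Cmod (CInt (fun y => G (a, y)) c e) <= V1 -> Cmod (CInt (fun y => G (b, y)) c e) <= V2 ->
  Cmod (rect_int G a b c e) <= H1 + H2 + V1 + V2.
Proof.
intros h1 h2 v1 v2; unfold rect_int, Cminus.
eapply Rle_trans; [apply Cmod_triangle |].
rewrite Cmod_opp, Cmod_mult, Cmod_Ci.
pose proof (Cmod_triangle (CInt (fun x => G (x, c)) a b + Ci * CInt (fun y => G (b, y)) c e)
  (- CInt (fun x => G (x, e)) a b))%C as T1.
pose proof (Cmod_triangle (CInt (fun x => G (x, c)) a b) (Ci * CInt (fun y => G (b, y)) c e))%C as T2.
rewrite Cmod_opp in T1; rewrite Cmod_mult, Cmod_Ci in T2; lra.
Qed.

Lemma Cmod_rect_int_le_const (G : C -> C) (a b c e B : R) : a <= b -> c <= e ->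
  continuous_on_boundary G a b c e ->
  (forall x y, a <= x <= b -> c <= y <= e -> x = a \/ x = b \/ y = c \/ y = e ->
     Cmod (G (x, y)) <= B) ->
  Cmod (rect_int G a b c e) <= 2 * ((b - a) + (e - c)) * B.
Proof.
intros Hab Hce Hc HB.
replace (2 * ((b - a) + (e - c)) * B)
  with ((b - a) * B + (b - a) * B + (e - c) * B + (e - c) * B) by ring.
apply Cmod_rect_int_le; apply Cmod_CInt_le_const; try assumption;
  [| apply ex_CInt_hline | | apply ex_CInt_hline | | apply ex_CInt_vline
   | | apply ex_CInt_vline]; try assumption; intros; (apply HB || apply Hc); auto; lra.
Qed.

Lemma rect_int_minus (G1 G2 : C -> C) (a b c e : R) : a <= b -> c <= e ->
  continuous_on_boundary G1 a b c e -> continuous_on_boundary G2 a b c e ->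
  rect_int (fun z => G1 z - G2 z)%C a b c e = (rect_int G1 a b c e - rect_int G2 a b c e)%C.
Proof.
intros Hab Hce H1 H2; unfold rect_int.
assert (Eh : forall y, y = c \/ y = e ->
  CInt (fun x => G1 (x, y) - G2 (x, y))%C a b
  = (CInt (fun x => G1 (x, y)) a b - CInt (fun x => G2 (x, y)) a b)%C).
{ intros y Hy; apply (CInt_minus (fun x => G1 (x, y)) (fun x => G2 (x, y))); apply ex_CInt_hline; try exact Hab;
    intros; (apply H1 || apply H2); try tauto; lra. }
assert (Ev : forall x, x = a \/ x = b ->
  CInt (fun y => G1 (x, y) - G2 (x, y))%C c e
  = (CInt (fun y => G1 (x, y)) c e - CInt (fun y => G2 (x, y)) c e)%C).
{ intros x Hx; apply (CInt_minus (fun y => G1 (x, y)) (fun y => G2 (x, y))); apply ex_CInt_vline; try exact Hce;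
    intros; (apply H1 || apply H2); try tauto; lra. }
rewrite (Eh c), (Eh e), (Ev a), (Ev b) by tauto.
ring.
Qed.

Lemma is_RInt_affine (p q a b : R) :
  is_RInt (fun x => p + q * x) a b (p * (b - a) + q * (b ^ 2 - a ^ 2) / 2).
Proof.
replace (p * (b - a) + q * (b ^ 2 - a ^ 2) / 2)
  with (minus ((fun x => p * x + q * x ^ 2 / 2) b) ((fun x => p * x + q * x ^ 2 / 2) a))
  by (unfold minus, plus, opp; simpl; field).
apply (is_RInt_derive (V := R_CompleteNormedModule) (fun x => p * x + q * x ^ 2 / 2)).
- intros x _; auto_derive; [exact I | simpl; field].
- intros x _; apply continuity_pt_filterlim; reg.
Qed.

Lemma CInt_affine (p q : C) (a b : R) :
  CInt (fun x => p + q * RtoC x)%C a b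
  = (p * RtoC (b - a) + q * RtoC ((b ^ 2 - a ^ 2) / 2))%C.
Proof.
apply (is_RInt_unique (V := C_R_CompleteNormedModule)).
destruct p as [p1 p2], q as [q1 q2].
replace ((p1, p2) * RtoC (b - a) + (q1, q2) * RtoC ((b ^ 2 - a ^ 2) / 2))%C
  with ((p1 * (b - a) + q1 * (b ^ 2 - a ^ 2) / 2, p2 * (b - a) + q2 * (b ^ 2 - a ^ 2) / 2))
  by (unfold Cplus, Cmult, RtoC; simpl; f_equal; field).
apply (is_RInt_fct_extend_pair (U := R_NormedModule) (V := R_NormedModule)).
- apply (is_RInt_ext (fun x => p1 + q1 * x)); [| apply is_RInt_affine].
  intros x _; simpl; ring.
- apply (is_RInt_ext (fun x => p2 + q2 * x)); [| apply is_RInt_affine].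
  intros x _; simpl; ring.
Qed.

Lemma CInt_ext (f g : R -> C) (a b : R) :
  (forall x, f x = g x) -> CInt f a b = CInt g a b.
Proof. intros H; apply (RInt_ext (V := C_R_CompleteNormedModule)); intros x _; apply H. Qed.

(** Proved by explicit integration. In Goursat's argument it discards the first-order part of [G] at
    the limit point. *)
Lemma rect_int_affine (p q : C) (a b c e : R) :
  rect_int (fun z => p + q * z)%C a b c e = 0.
Proof.
unfold rect_int.
assert (Hh : forall y, CInt (fun x => p + q * (x, y))%C a b
   = CInt (fun x => (p + q * (Ci * RtoC y)) + q * RtoC x)%C a b).
{ intros y; apply CInt_ext; intros x.
  unfold Cplus, Cmult, RtoC, Ci; simpl; f_equal; ring. }
assert (Hv : forall x, CInt (fun y => p + q * (x, y))%C c e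
   = CInt (fun y => (p + q * RtoC x) + (q * Ci) * RtoC y)%C c e).
{ intros x; apply CInt_ext; intros y.
  unfold Cplus, Cmult, RtoC, Ci; simpl; f_equal; ring. }
rewrite !Hh, !Hv, !CInt_affine.
destruct p as [p1 p2], q as [q1 q2].
unfold Cminus, Cplus, Copp, Cmult, RtoC, Ci; simpl; f_equal; field.
Qed.

Lemma Cmod_le_sum (z : C) : Cmod z <= Rabs (Re z) + Rabs (Im z).
Proof.
replace z with (RtoC (Re z) + Ci * RtoC (Im z))%C at 1
  by (destruct z; unfold Re, Im, Cplus, Cmult, Ci, RtoC; simpl; f_equal; ring).
eapply Rle_trans; [apply Cmod_triangle |].
rewrite Cmod_mult, Cmod_Ci, !Cmod_R; lra.
Qed.

(** * Goursat's theorem by bisection *)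

Lemma nested_intervals_point (u : nat -> R) (W : R) : 0 <= W ->
  (forall k, u k <= u (S k) /\ u (S k) + W / 2 ^ S k <= u k + W / 2 ^ k) ->
  exists A, forall k, u k <= A <= u k + W / 2 ^ k.
Proof.
intros HW H.
assert (Hpos : forall k, 0 <= W / 2 ^ k)
  by (intros k; apply Rle_mult_inv_pos; [exact HW | apply pow_lt; lra]).
assert (Hj : forall k j, u k <= u (k + j)%nat
          /\ u (k + j)%nat + W / 2 ^ (k + j) <= u k + W / 2 ^ k).
{ intros k j; induction j as [| j IH].
  - rewrite Nat.add_0_r; lra.
  - rewrite Nat.add_succ_r; pose proof (H (k + j)%nat); lra. }
assert (Hkm : forall k m, u k <= u m + W / 2 ^ m).
{ intros k m; destruct (Nat.le_ge_cases k m) as [L | L].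
  - replace m with (k + (m - k))%nat by lia.
    pose proof (proj1 (Hj k (m - k)%nat)); pose proof (Hpos (k + (m - k))%nat); lra.
  - replace k with (m + (k - m))%nat by lia.
    pose proof (proj2 (Hj m (k - m)%nat)); pose proof (Hpos (m + (k - m))%nat); lra. }
destruct (completeness (fun x => exists k, x = u k)) as [A [Hub Hlub]].
- exists (u 0%nat + W / 2 ^ 0); intros x [k ->]; apply Hkm.
- exists (u 0%nat); exists 0%nat; reflexivity.
- exists A; intros k; split.
  + apply Hub; exists k; reflexivity.
  + apply Hlub; intros x [j ->]; apply Hkm.
Qed.

(* The lower left corner of a quarter of a rectangle with lower left corner [p]
   whose weight [I] is at least [t], if there is one. *)
Definition quarter (I : R -> R -> R) (w v t : R) (p : R * R) : R * R :=
  let (x, y) := p in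
  if Rle_dec t (I x y) then (x, y)
  else if Rle_dec t (I (x + w) y) then (x + w, y)
  else if Rle_dec t (I x (y + v)) then (x, y + v)
  else (x + w, y + v).

Lemma quarter_range (I : R -> R -> R) (w v t : R) (p : R * R) : 0 <= w -> 0 <= v ->
  fst p <= fst (quarter I w v t p) <= fst p + w
  /\ snd p <= snd (quarter I w v t p) <= snd p + v.
Proof.
intros Hw Hv; destruct p as [x y]; unfold quarter.
repeat destruct Rle_dec; simpl; lra.
Qed.

(** Pigeonhole: when the three tests fail, the last quarter is left with more than
    [4 * t - 3 * t]. *)
Lemma quarter_weight (I : R -> R -> R) (w v t x y : R) :
  4 * t <= I x y + I (x + w) y + I x (y + v) + I (x + w) (y + v) ->
  t <= I (fst (quarter I w v t (x, y))) (snd (quarter I w v t (x, y))).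
Proof.
intros Ht; unfold quarter; repeat destruct Rle_dec; simpl; lra.
Qed.

Lemma Cmod_rect_int_quarters (G : C -> C) (x y w v : R) : 0 <= w -> 0 <= v ->
  continuous_on_rect G x (x + w + w) y (y + v + v) ->
  let I := fun x y => Cmod (rect_int G x (x + w) y (y + v)) in
  Cmod (rect_int G x (x + w + w) y (y + v + v))
  <= I x y + I (x + w) y + I x (y + v) + I (x + w) (y + v).
Proof.
intros Hw Hv Hc; cbv zeta beta.
rewrite (rect_int_hsplit G x (x + w) (x + w + w));
  [| lra | intros; split; apply Hc; lra].
rewrite (rect_int_vsplit G x (x + w) y (y + v) (y + v + v));
  [| lra | intros; split; apply Hc; lra].
rewrite (rect_int_vsplit G (x + w) (x + w + w) y (y + v) (y + v + v));
  [| lra | intros; split; apply Hc; lra].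
generalize (rect_int G x (x + w) y (y + v)) (rect_int G (x + w) (x + w + w) y (y + v))
  (rect_int G x (x + w) (y + v) (y + v + v)) (rect_int G (x + w) (x + w + w) (y + v) (y + v + v)).
intros I1 I2 I3 I4.
pose proof (Cmod_triangle (I1 + I3) (I2 + I4)).
pose proof (Cmod_triangle I1 I3); pose proof (Cmod_triangle I2 I4).
lra.
Qed.

Lemma Ccontinuous_minus (f g : C -> C) (z : C) :
  Ccontinuous f z -> Ccontinuous g z -> Ccontinuous (fun w => f w - g w)%C z.
Proof.
intros Hf Hg.
exact (continuous_minus (U := AbsRing_UniformSpace C_AbsRing)
  (V := AbsRing_NormedModule C_AbsRing) f g z Hf Hg).
Qed.

(** If the integral had modulus [eta > 0], repeated quartering would give nested rectangles with
    integrals at least [eta / 4 ^ k], while differentiability at their common point makes the k-th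
    integral smaller than that. Degenerate rectangles are included. *)
Theorem goursat_rect (G : C -> C) (a b c e : R) : a <= b -> c <= e ->
  (forall x y, a <= x <= b -> c <= y <= e -> Cderivable G (x, y)) ->
  rect_int G a b c e = 0.
Proof.
intros Hab Hce HG.
destruct (Ceq_dec (rect_int G a b c e) 0) as [E | E]; [exact E | exfalso].
set (eta := Cmod (rect_int G a b c e)).
assert (Heta : 0 < eta) by (apply Cmod_gt_0; exact E).
assert (HC : forall x y, a <= x <= b -> c <= y <= e -> Ccontinuous G (x, y))
  by (intros; apply Cderivable_continuous, HG; assumption).
set (W := b - a); set (V := e - c).
assert (HW : 0 <= W) by (unfold W; lra); assert (HV : 0 <= V) by (unfold V; lra).
assert (HWk : forall U k, 0 <= U -> 0 <= U / 2 ^ k)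
  by (intros U k HU; apply Rle_mult_inv_pos; [exact HU | apply pow_lt; lra]).
assert (Hhalf : forall U k, U / 2 ^ k = U / 2 ^ S k + U / 2 ^ S k)
  by (intros U k; simpl; field; apply pow_nonzero; lra).
set (I := fun k x y => Cmod (rect_int G x (x + W / 2 ^ k) y (y + V / 2 ^ k))).
set (p := fix p (k : nat) : R * R := match k with
  | O => (a, c)
  | S j => quarter (I (S j)) (W / 2 ^ S j) (V / 2 ^ S j) (eta / 4 ^ S j) (p j) end).
assert (Hp0 : p 0%nat = (a, c)) by reflexivity.
assert (HpS : forall j, p (S j)
   = quarter (I (S j)) (W / 2 ^ S j) (V / 2 ^ S j) (eta / 4 ^ S j) (p j)) by reflexivity.
clearbody p.
assert (Hr : forall k, (a <= fst (p k) /\ fst (p k) + W / 2 ^ k <= b)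
     /\ (c <= snd (p k) /\ snd (p k) + V / 2 ^ k <= e)).
{ induction k as [| k IH].
  - rewrite Hp0; simpl; unfold W, V; lra.
  - rewrite HpS.
    pose proof (quarter_range (I (S k)) (W / 2 ^ S k) (V / 2 ^ S k) (eta / 4 ^ S k) (p k)
      (HWk W _ HW) (HWk V _ HV)).
    rewrite (Hhalf W k), (Hhalf V k) in IH; lra. }
(* The invariant of the bisection: each choice of a quarter loses at most a factor 4. *)
assert (Hinv : forall k, eta / 4 ^ k <= I k (fst (p k)) (snd (p k))).
{ induction k as [| k IH].
  - rewrite Hp0; unfold I; simpl; unfold W, V, eta.
    replace (a + (b - a) / 1) with b by field; replace (c + (e - c) / 1) with e by field; lra.
  - rewrite HpS; pose proof (Hr k) as Hrk; destruct (p k) as [x y]; cbn [fst snd] in IH, Hrk.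
    apply quarter_weight.
    replace (4 * (eta / 4 ^ S k)) with (eta / 4 ^ k) by (simpl; field; apply pow_nonzero; lra).
    eapply Rle_trans; [exact IH |]; unfold I at 1.
    rewrite (Hhalf W k), (Hhalf V k), <- !Rplus_assoc.
    apply Cmod_rect_int_quarters; try (apply HWk; assumption).
    rewrite (Hhalf W k), (Hhalf V k) in Hrk.
    intros x' y' Hx Hy; apply HC; lra. }
destruct (nested_intervals_point (fun k => fst (p k)) W HW) as [A HA].
{ intros k; rewrite HpS.
  pose proof (quarter_range (I (S k)) (W / 2 ^ S k) (V / 2 ^ S k) (eta / 4 ^ S k) (p k)
      (HWk W _ HW) (HWk V _ HV)); rewrite (Hhalf W k); lra. }
destruct (nested_intervals_point (fun k => snd (p k)) V HV) as [B HB].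
{ intros k; rewrite HpS.
  pose proof (quarter_range (I (S k)) (W / 2 ^ S k) (V / 2 ^ S k) (eta / 4 ^ S k) (p k)
      (HWk W _ HW) (HWk V _ HV)); rewrite (Hhalf V k); lra. }
assert (HAB : Cderivable G (A, B)).
{ pose proof (HA 0%nat) as H1; pose proof (HB 0%nat) as H2; rewrite Hp0 in H1, H2.
  simpl in H1, H2; unfold W, V in H1, H2; apply HG; lra. }
destruct HAB as [l Hl].
set (s := W + V).
assert (Hs : 0 <= s) by (unfold s; lra).
(* With this tolerance the k-th integral is at most [eta / 4 ^ k] times s^2 / (2 (s^2 + 1)), a
   factor below 1. The summand 1 covers [s = 0]. *)
destruct (proj1 (Cis_derive_eps G (A, B) l) Hl (eta / (4 * (s ^ 2 + 1)))) as [delta [Hd Hlin]].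
{ apply Rdiv_lt_0_compat; [exact Heta | nra]. }
destruct (pow_lt_1_zero (/ 2) ltac:(rewrite Rabs_pos_eq; lra) (delta / (s + 1))
  ltac:(apply Rdiv_lt_0_compat; lra)) as [k Hk].
specialize (Hk k (Nat.le_refl k)).
rewrite Rabs_pos_eq, pow_inv in Hk by (apply pow_le; lra).
assert (H2k : 0 < 2 ^ k) by (apply pow_lt; lra).
assert (Hsk : s / 2 ^ k < delta).
{ apply Rle_lt_trans with ((s + 1) * / 2 ^ k).
  - unfold Rdiv; apply Rmult_le_compat_r; [left; apply Rinv_0_lt_compat; exact H2k | lra].
  - rewrite Rmult_comm; apply Rlt_div_r; [lra | exact Hk]. }
specialize (HA k); specialize (HB k); specialize (Hr k); specialize (Hinv k); cbv beta in HA, HB.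
set (x := fst (p k)) in *; set (y := snd (p k)) in *.
set (w := W / 2 ^ k) in *; set (v := V / 2 ^ k) in *.
assert (Hwv : w + v = s / 2 ^ k) by (unfold w, v, s; field; lra).
assert (Hw0 : 0 <= w) by (apply HWk; exact HW).
assert (Hv0 : 0 <= v) by (apply HWk; exact HV).
(* Subtracting the tangent [P + l * z] at [(A, B)] leaves the integral unchanged. What remains is of
   size tolerance times distance, and both distance and half-perimeter are bounded by [w + v]. *)
assert (Hbound : Cmod (rect_int G x (x + w) y (y + v))
          <= 2 * (w + v) * (eta / (4 * (s ^ 2 + 1)) * (w + v))).
{ pose (P := (G (A, B) - (A, B) * l)%C).
  assert (Caff : forall z, Ccontinuous (fun z => P + l * z)%C z).
  { intros z; apply Cderivable_continuous; exists (RtoC 0 + l)%C.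
    apply (is_derive_plus (K := C_AbsRing) (V := AbsRing_NormedModule C_AbsRing)
      (fun _ => P) (fun z => l * z)%C).
    - apply (is_derive_const (K := C_AbsRing) (V := AbsRing_NormedModule C_AbsRing) P).
    - apply Cis_derive_eps; intros eps Heps; exists 1; split; [lra |]; intros z' _.
      replace (l * z' - l * z - (z' - z) * l)%C with (RtoC 0) by ring.
      rewrite Cmod_0; apply Rmult_le_pos; [lra | apply Cmod_ge_0]. }
  assert (Erem : rect_int (fun z => G z - (P + l * z))%C x (x + w) y (y + v)
     = rect_int G x (x + w) y (y + v)).
  { rewrite rect_int_minus; try lra.
    - rewrite rect_int_affine; ring.
    - intros x' y' Hx' Hy' _; apply HC; lra.
    - intros x' y' _ _ _; apply Caff. }
  rewrite <- Erem.
  replace (2 * (w + v)) with (2 * ((x + w - x) + (y + v - y))) by ring.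
  apply Cmod_rect_int_le_const; try lra.
  - intros x' y' Hx' Hy' _.
    apply (Ccontinuous_minus G (fun z => P + l * z)%C); [apply HC; lra | apply Caff].
  - intros x' y' Hx' Hy' _.
    replace (G (x', y') - (P + l * (x', y')))%C
      with (G (x', y') - G (A, B) - ((x', y') - (A, B)) * l)%C by (unfold P; ring).
    assert (Hdist : Cmod ((x', y') - (A, B)) <= w + v).
    { eapply Rle_trans; [apply Cmod_le_sum |]; simpl.
      apply Rplus_le_compat; apply Rabs_le; lra. }
    eapply Rle_trans; [apply Hlin; lra |].
    apply Rmult_le_compat_l; [| exact Hdist].
    left; apply Rdiv_lt_0_compat; [exact Heta | nra]. }
assert (H4k : 4 ^ k = 2 ^ k * 2 ^ k) by (rewrite <- Rpow_mult_distr; f_equal; ring).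
unfold I in Hinv; pose proof (Rle_trans _ _ _ Hinv Hbound) as F.
rewrite Hwv, H4k in F.
replace (2 * (s / 2 ^ k) * (eta / (4 * (s ^ 2 + 1)) * (s / 2 ^ k)))
  with ((eta / (2 ^ k * 2 ^ k)) * (s ^ 2 / (2 * (s ^ 2 + 1)))) in F by (field; split; apply Rgt_not_eq; [lra | nra]).
assert (Hpos : 0 < eta / (2 ^ k * 2 ^ k)) by (apply Rdiv_lt_0_compat; nra).
assert (Hlt : s ^ 2 / (2 * (s ^ 2 + 1)) < 1) by (apply Rlt_div_l; nra).
nra.
Qed.

(** * Residues at simple poles on the real axis *)

Lemma plus_sqr_neq_0 (u s : R) : s <> 0 -> u ^ 2 + s ^ 2 <> 0.
Proof.
intros Hs; apply Rgt_not_eq.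
pose proof (pow2_ge_0 u); pose proof (pow2_gt_0 s Hs); lra.
Qed.

(** The primitive is atan((x - m) / s). The half-length of the interval equals [s], so the arguments
    at the ends are 1 and -1, whatever [s] is. *)
Lemma CInt_cauchy_kernel (w : C) (m s : R) : 0 < s ->
  CInt (fun x => w * RtoC (s / ((x - m) ^ 2 + s ^ 2)))%C (m - s) (m + s) = (w * RtoC (PI / 2))%C.
Proof.
intros Hs.
assert (H : forall q, is_RInt (fun x => q * (s / ((x - m) ^ 2 + s ^ 2))) (m - s) (m + s)
    (q * (PI / 2))).
{ intros q.
  replace (q * (PI / 2)) with
    (minus ((fun x => q * atan ((x - m) / s)) (m + s)) ((fun x => q * atan ((x - m) / s)) (m - s))).
  2: { unfold minus, plus, opp; simpl.
    replace ((m + s - m) / s) with 1 by (field; lra).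
    replace ((m - s - m) / s) with (- (1)) by (field; lra).
    rewrite atan_opp, atan_1; field. }
  apply (is_RInt_derive (V := R_CompleteNormedModule) (fun x => q * atan ((x - m) / s))).
  - intros x _; auto_derive; [lra |]; field; split; [apply plus_sqr_neq_0 |]; lra.
  - intros x _; apply continuity_pt_filterlim; reg; apply plus_sqr_neq_0; lra. }
apply (is_RInt_unique (V := C_R_CompleteNormedModule)).
destruct w as [w1 w2].
replace ((w1, w2) * RtoC (PI / 2))%C with (w1 * (PI / 2), w2 * (PI / 2))
  by (unfold Cmult, RtoC; simpl; f_equal; ring).
apply (is_RInt_fct_extend_pair (U := R_NormedModule) (V := R_NormedModule)).
- eapply is_RInt_ext; [| apply (H w1)]; intros x _; simpl; ring.
- eapply is_RInt_ext; [| apply (H w2)]; intros x _; simpl; ring.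
Qed.

Lemma Cderivable_sub_const (p z : C) : Cderivable (fun w => w - p)%C z.
Proof.
exists (RtoC 1); apply Cis_derive_eps; intros eps Heps; exists 1; split; [lra |]; intros w _.
replace (w - p - (z - p) - (w - z) * 1)%C with (RtoC 0) by ring.
rewrite Cmod_0; apply Rmult_le_pos; [lra | apply Cmod_ge_0].
Qed.

Lemma Cderivable_const (p z : C) : Cderivable (fun _ => p) z.
Proof. apply (ex_derive_const (K := C_AbsRing) (V := AbsRing_NormedModule C_AbsRing) p z). Qed.

Lemma Cderivable_simple_pole (r p z : C) : z <> p -> Cderivable (fun w => r * / (w - p))%C z.
Proof.
intros H; apply Cderivable_mult; [apply Cderivable_const |].
apply (Cderivable_inv (fun w => w - p)%C); [apply Cminus_eq_contra, H | apply Cderivable_sub_const].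
Qed.

(** On a square centred at the pole, opposite sides are subtracted before integrating: one part of 1
    / (z - p) cancels and the other doubles to a multiple of s / (t^2 + s^2). Each of the two pairs
    contributes pi i r. *)
Lemma rect_int_simple_pole (r : C) (p s : R) : 0 < s ->
  rect_int (fun z => r * / (z - RtoC p))%C (p - s) (p + s) (- s) s = (2 * PI * Ci * r)%C.
Proof.
intros Hs; unfold rect_int.
assert (Hneq : forall x y, x = p - s \/ x = p + s \/ y = - s \/ y = s -> (x, y) <> RtoC p).
{ intros x y H E; injection E; intros; lra. }
assert (Hc : forall x y, x = p - s \/ x = p + s \/ y = - s \/ y = s ->
   Ccontinuous (fun z => r * / (z - RtoC p))%C (x, y)).
{ intros x y H; apply Cderivable_continuous, Cderivable_simple_pole, Hneq, H. }
assert (Hh : (CInt (fun x => r * / ((x, (- s)%R) - RtoC p)) (p - s) (p + s)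
   - CInt (fun x => r * / ((x, s) - RtoC p)) (p - s) (p + s))%C = (r * 2 * Ci * RtoC (PI / 2))%C).
{ rewrite <- CInt_minus by (apply (ex_CInt_hline (fun z => r * / (z - RtoC p))%C);
    [lra | intros; apply Hc; auto]).
  rewrite <- (CInt_cauchy_kernel _ p s Hs); apply CInt_ext; intros x.
  destruct r as [r1 r2].
  unfold Cminus, Cplus, Cmult, Cinv, Copp, Ci, RtoC; simpl; f_equal; field;
  intros E; apply (plus_sqr_neq_0 (x - p) s); try lra; rewrite <- E; ring. }
assert (Hv : (CInt (fun y => r * / (((p + s)%R, y) - RtoC p)) (- s) s
   - CInt (fun y => r * / (((p - s)%R, y) - RtoC p)) (- s) s)%C = (r * 2 * RtoC (PI / 2))%C).
{ rewrite <- CInt_minus by (apply (ex_CInt_vline (fun z => r * / (z - RtoC p))%C);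
    [lra | intros; apply Hc; auto]).
  replace (- s) with (0 - s) by ring; replace s with (0 + s) at 2 by ring.
  rewrite <- (CInt_cauchy_kernel _ 0 s Hs); apply CInt_ext; intros y.
  destruct r as [r1 r2].
  unfold Cminus, Cplus, Cmult, Cinv, Copp, Ci, RtoC; simpl; f_equal; field;
  intros E; apply (plus_sqr_neq_0 y s); try lra; rewrite <- E; ring. }
match goal with |- (?A + Ci * ?B - ?D - Ci * ?E)%C = _ =>
  replace (A + Ci * B - D - Ci * E)%C with ((A - D) + Ci * (B - E))%C by ring end.
rewrite Hh, Hv.
replace (2 * PI)%C with (RtoC 4 * RtoC (PI / 2))%C
  by (rewrite <- !RtoC_mult; apply f_equal; field).
replace (RtoC 4) with (RtoC 2 + RtoC 2)%C by (rewrite <- RtoC_plus; f_equal; ring).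
ring.
Qed.

(** The limit of (z - p) G(z) is [r], over a punctured neighbourhood, so the value of [G] at [p] is
    irrelevant. A removable singularity is the case [r = 0]. *)
Definition simple_pole (G : C -> C) (p : R) (r : C) : Prop :=
  forall eps, 0 < eps -> exists delta, 0 < delta /\ forall z, z <> RtoC p ->
    Cmod (z - RtoC p) < delta -> Cmod ((z - RtoC p) * G z - r)%C <= eps.

(** Goursat's theorem on the surrounding pieces shrinks the rectangle to a small square around [p],
    on which [G] is compared with r / (z - p). *)
Lemma rect_int_residue (G : C -> C) (a b c e p : R) (r : C) :
  a < p < b -> c < 0 < e ->
  (forall x y, a <= x <= b -> c <= y <= e -> (x, y) <> RtoC p -> Cderivable G (x, y)) ->
  simple_pole G p r ->
  rect_int G a b c e = (2 * PI * Ci * r)%C.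
Proof.
intros Hp H0 HG Hr.
assert (Hne : forall x y, x <> p \/ y <> 0 -> (x, y) <> RtoC p)
  by (intros x y H E; injection E; intros; lra).
assert (HC : forall x y, a <= x <= b -> c <= y <= e -> x <> p \/ y <> 0 -> Ccontinuous G (x, y))
  by (intros; apply Cderivable_continuous, HG, Hne; assumption).
assert (Hshrink : forall s, 0 < s -> a <= p - s -> p + s <= b -> c <= - s -> s <= e ->
  rect_int G a b c e = rect_int G (p - s) (p + s) (- s) s).
{ intros s Hs h1 h2 h3 h4.
  rewrite (rect_int_hsplit G a (p - s) b); [| lra | intros; split; apply HC; lra].
  rewrite (rect_int_hsplit G (p - s) (p + s) b); [| lra | intros; split; apply HC; lra].
  rewrite (rect_int_vsplit G (p - s) (p + s) c (- s) e); [| lra | intros; split; apply HC; lra].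
  rewrite (rect_int_vsplit G (p - s) (p + s) (- s) s e); [| lra | intros; split; apply HC; lra].
  rewrite (goursat_rect G a (p - s)), (goursat_rect G (p + s) b),
    (goursat_rect G (p - s) (p + s) c (- s)), (goursat_rect G (p - s) (p + s) s e);
    try lra; try (intros; apply HG; try lra; apply Hne; lra).
  ring. }
destruct (Ceq_dec (rect_int G a b c e) (2 * PI * Ci * r)) as [E | E]; [exact E | exfalso].
set (D := Cmod (rect_int G a b c e - 2 * PI * Ci * r)).
assert (HD : 0 < D) by (apply Cmod_gt_0, Cminus_eq_contra, E).
(* The square of half-side [s] has perimeter 8 s and the difference is at most (D / 16) / s on it,
   so the two integrals differ by at most D / 2, against their distance [D]. *)
destruct (Hr (D / 16) ltac:(lra)) as [delta [Hdelta Hlim]].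
(* Points of the square lie within 2 s of [p], hence the division by 3; the other terms keep the
   square inside the rectangle. *)
set (s := Rmin (delta / 3) (Rmin (Rmin (p - a) (b - p)) (Rmin (- c) e))).
assert (Hs : 0 < s) by (unfold s; repeat apply Rmin_glb_lt; lra).
assert (Hsb : s <= delta / 3 /\ s <= p - a /\ s <= b - p /\ s <= - c /\ s <= e).
{ unfold s, Rmin; repeat destruct Rle_dec; lra. }
clearbody s.
assert (Hcont2 : continuous_on_boundary (fun z => r * / (z - RtoC p))%C (p - s) (p + s) (- s) s).
{ intros x y Hx Hy Hb; apply Cderivable_continuous, Cderivable_simple_pole, Hne; lra. }
assert (Hcont1 : continuous_on_boundary G (p - s) (p + s) (- s) s).
{ intros x y Hx Hy Hb; apply HC; lra. }
assert (Hbound : D <= 2 * ((p + s - (p - s)) + (s - - s)) * (D / 16 / s)).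
{ unfold D at 1; rewrite (Hshrink s), <- (rect_int_simple_pole r p s) by lra.
  rewrite <- rect_int_minus by (assumption || lra).
  apply Cmod_rect_int_le_const; try lra.
  - intros x y Hx Hy Hb.
    apply (Ccontinuous_minus G (fun z => r * / (z - RtoC p))%C); [apply Hcont1 | apply Hcont2]; assumption.
  - intros x y Hx Hy Hb.
    assert (Hz : (x, y) <> RtoC p) by (apply Hne; lra).
    assert (Hlow : s <= Cmod ((x, y) - RtoC p)).
    { eapply Rle_trans; [| apply Rmax_Cmod]; simpl.
      destruct Hb as [Hb | [Hb | [Hb | Hb]]];
        (eapply Rle_trans; [| apply Rmax_l]; unfold Rabs; destruct Rcase_abs; lra)
        || (eapply Rle_trans; [| apply Rmax_r]; unfold Rabs; destruct Rcase_abs; lra). }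
    assert (Hup : Cmod ((x, y) - RtoC p) < delta).
    { apply Rle_lt_trans with (s + s); [| lra].
      eapply Rle_trans; [apply Cmod_le_sum |]; simpl.
      apply Rplus_le_compat; apply Rabs_le; lra. }
    replace (G (x, y) - r * / ((x, y) - RtoC p))%C
      with ((((x, y) - RtoC p) * G (x, y) - r) / ((x, y) - RtoC p))%C
      by (field; apply Cminus_eq_contra, Hz).
    rewrite Cmod_div by (apply Cminus_eq_contra, Hz).
    unfold Rdiv at 1; apply Rmult_le_compat;
      [apply Cmod_ge_0 | left; apply Rinv_0_lt_compat; lra | apply Hlim; assumption |].
    apply Rinv_le_contravar; assumption. }
replace (2 * ((p + s - (p - s)) + (s - - s)) * (D / 16 / s)) with (D / 2) in Hbound by (field; lra).
lra.
Qed.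

(** * Sums over integer intervals and poles on a lattice *)

(** The induction starts at [a - 1], the upper index at which [sum_Z a] is the empty sum. *)
Lemma Z_ind_from (a : Z) (P : Z -> Prop) : P (a - 1)%Z ->
  (forall b, (a - 1 <= b)%Z -> P b -> P (b + 1)%Z) -> forall b, (a - 1 <= b)%Z -> P b.
Proof.
intros H0 HS b Hb.
replace b with (a - 1 + (b - (a - 1)))%Z by lia.
apply (natlike_ind (fun i => P (a - 1 + i)%Z)); [| | lia].
- rewrite Z.add_0_r; exact H0.
- intros i Hi IH; replace (a - 1 + Z.succ i)%Z with (a - 1 + i + 1)%Z by lia.
  apply HS; [lia | exact IH].
Qed.

Lemma fold_right_Cplus_app (l1 l2 : list C) :
  fold_right Cplus (RtoC 0) (l1 ++ l2)
  = (fold_right Cplus (RtoC 0) l1 + fold_right Cplus (RtoC 0) l2)%C.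
Proof. induction l1 as [| x l1 IH]; simpl; [ring | rewrite IH; ring]. Qed.

Lemma sum_Z_empty (a : Z) (g : Z -> C) : sum_Z a (a - 1) g = 0.
Proof. unfold sum_Z; replace (a - 1 - a + 1)%Z with 0%Z by lia; reflexivity. Qed.

Lemma sum_Z_succ (a b : Z) (g : Z -> C) : (a - 1 <= b)%Z ->
  sum_Z a (b + 1) g = (sum_Z a b g + g (b + 1)%Z)%C.
Proof.
intros H; unfold sum_Z.
replace (Z.to_nat (b + 1 - a + 1)) with (Z.to_nat (b - a + 1) + 1)%nat by lia.
rewrite seq_app, map_app, fold_right_Cplus_app; simpl.
rewrite Z2Nat.id by lia; replace (a + (b - a + 1))%Z with (b + 1)%Z by lia.
ring.
Qed.

Lemma sum_Z_split (a m b : Z) (g : Z -> C) : (a - 1 <= m)%Z -> (m <= b)%Z ->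
  sum_Z a b g = (sum_Z a m g + sum_Z (m + 1) b g)%C.
Proof.
intros Ham Hmb; pattern b; apply (Z_ind_from (m + 1)); [| | lia].
- rewrite sum_Z_empty; replace (m + 1 - 1)%Z with m by lia; ring.
- intros k Hk IH; rewrite !sum_Z_succ, IH by lia; ring.
Qed.

Lemma sum_Z_ext (a b : Z) (f g : Z -> C) : (a - 1 <= b)%Z ->
  (forall k, (a <= k <= b)%Z -> f k = g k) -> sum_Z a b f = sum_Z a b g.
Proof.
intros Hab; pattern b; apply (Z_ind_from a); [| | exact Hab].
- intros _; rewrite !sum_Z_empty; reflexivity.
- intros c Hc IH H; rewrite !sum_Z_succ, IH, H by (intros; try apply H; lia); reflexivity.
Qed.

Lemma sum_Z_scal (a b : Z) (q : C) (g : Z -> C) : (a - 1 <= b)%Z ->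
  (q * sum_Z a b g)%C = sum_Z a b (fun k => q * g k)%C.
Proof.
intros Hab; pattern b; apply (Z_ind_from a); [| | exact Hab].
- rewrite !sum_Z_empty; ring.
- intros c Hc IH; rewrite !sum_Z_succ, <- IH by lia; ring.
Qed.

Lemma Cmod_sum_Z_telescope (a b : Z) (g : Z -> C) (T : Z -> R) : (a - 1 <= b)%Z ->
  (forall k, (a <= k <= b)%Z -> Cmod (g k) <= T (k - 1)%Z - T k) ->
  Cmod (sum_Z a b g) <= T (a - 1)%Z - T b.
Proof.
intros Hab; pattern b; apply (Z_ind_from a); [| | exact Hab].
- intros _; rewrite sum_Z_empty, Cmod_0; lra.
- intros c Hc IH H; rewrite sum_Z_succ by lia.
  eapply Rle_trans; [apply Cmod_triangle |].
  pose proof (H (c + 1)%Z ltac:(lia)) as H1; replace (c + 1 - 1)%Z with c in H1 by lia.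
  assert (IH' := IH ltac:(intros; apply H; lia)); lra.
Qed.

Lemma lattice_between (h : R) (i k : Z) : 0 < h ->
  ~ (IZR i * h < IZR k * h < IZR (i + 1) * h).
Proof.
intros Hh [H1 H2]; apply Rmult_lt_reg_r in H1, H2; try exact Hh.
apply lt_IZR in H1, H2; lia.
Qed.

(** Induction on the last pole: a vertical cut just before it splits off a rectangle with that
    single pole, and the empty range is Goursat's theorem. *)
Lemma rect_int_lattice_poles (G : C -> C) (h c e : R) (j : Z) (r : Z -> C) :
  0 < h -> c < 0 < e -> forall m, (j - 1 <= m)%Z -> forall a b, a <= b ->
  IZR (j - 1) * h < a < IZR j * h -> IZR m * h < b < IZR (m + 1) * h ->
  (forall x y, a <= x <= b -> c <= y <= e -> (forall k, (x, y) <> RtoC (IZR k * h)) ->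
     Cderivable G (x, y)) ->
  (forall k, (j <= k <= m)%Z -> simple_pole G (IZR k * h) (r k)) ->
  rect_int G a b c e = (2 * PI * Ci * sum_Z j m r)%C.
Proof.
intros Hh Hce; refine (Z_ind_from j _ _ _).
- intros a b Hab Ha Hb HG _; rewrite sum_Z_empty, Cmult_0_r; apply goursat_rect; try lra.
  intros x y Hx Hy; apply HG; try assumption; intros k E; injection E; intros _ Ex.
  apply (lattice_between h (j - 1) k Hh); replace (j - 1 + 1)%Z with j in * by lia; lra.
- intros m Hm IH a b Hab Ha Hb HG Hr.
  assert (Hjm : IZR j * h <= IZR (m + 1) * h)
    by (apply Rmult_le_compat_r; [lra | apply IZR_le; lia]).
  assert (Hmm : IZR m * h < IZR (m + 1) * h)
    by (apply Rmult_lt_compat_r; [lra | apply IZR_lt; lia]).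
  (* The cut must lie to the right of the preceding lattice point and also of [a], which is the
     larger of the two when [m = j - 1]. *)
  set (q := (Rmax a (IZR m * h) + IZR (m + 1) * h) / 2).
  assert (Hq : a < q /\ IZR m * h < q /\ q < IZR (m + 1) * h)
    by (unfold q, Rmax; destruct Rle_dec; lra).
  assert (Hcut : forall x y, a <= x <= b -> c <= y <= e -> y <> 0 -> Cderivable G (x, y)).
  { intros x y Hx Hy Hn; apply HG; try assumption.
    intros k E; injection E; intros; contradiction. }
  rewrite (rect_int_hsplit G a q b)
    by (lra || (intros; split; apply Cderivable_continuous, Hcut; lra)).
  rewrite (IH a q), (rect_int_residue G q b c e (IZR (m + 1) * h) (r (m + 1)%Z)); try lra.
  + rewrite sum_Z_succ by exact Hm; ring.
  + intros x y Hx Hy Hne; apply HG; try lra; intros k E.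
    destruct (Z.eq_dec k (m + 1)) as [-> | Hk]; [contradiction |].
    injection E; intros _ Ex.
    assert (Hk1 : IZR m * h < IZR k * h < IZR (m + 1 + 1) * h) by lra.
    destruct Hk1 as [H1 H2]; apply Rmult_lt_reg_r in H1, H2; try exact Hh.
    apply lt_IZR in H1, H2; lia.
  + apply Hr; lia.
  + intros; apply HG; try assumption; lra.
  + intros; apply Hr; lia.
Qed.

(** * The complex sine *)

Lemma cosh_sqr (x : R) : cosh x ^ 2 = 1 + sinh x ^ 2.
Proof.
unfold cosh, sinh; replace 1 with (exp x * exp (- x)); [field |].
rewrite <- exp_plus, Rplus_opp_r, exp_0; reflexivity.
Qed.

Lemma cosh_ge_1 (x : R) : 1 <= cosh x.
Proof.
pose proof (cosh_sqr x); pose proof (pow2_ge_0 (sinh x)).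
assert (0 < cosh x) by (unfold cosh; pose proof (exp_pos x); pose proof (exp_pos (- x)); lra).
nra.
Qed.

Lemma sinh_opp (x : R) : sinh (- x) = - sinh x.
Proof. unfold sinh; rewrite Ropp_involutive; field. Qed.

Lemma cosh_opp (x : R) : cosh (- x) = cosh x.
Proof. unfold cosh; rewrite Ropp_involutive; field. Qed.

Lemma sinh_ge_0 (x : R) : 0 <= x -> 0 <= sinh x.
Proof.
intros [H | <-]; [| rewrite sinh_0; lra].
rewrite <- sinh_0; left; apply sinh_lt, H.
Qed.

Lemma sinh_gt_0 (x : R) : 0 < x -> 0 < sinh x.
Proof. intros H; rewrite <- sinh_0; apply sinh_lt, H. Qed.

Lemma sinh_le (x y : R) : x <= y -> sinh x <= sinh y.
Proof. intros [H | ->]; [left; apply sinh_lt, H | lra]. Qed.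

Lemma Cis_derive_mult (f g : C -> C) (z lf lg : C) :
  Cis_derive f z lf -> Cis_derive g z lg ->
  Cis_derive (fun w => f w * g w)%C z (lf * g z + f z * lg)%C.
Proof. intros Hf Hg; apply (is_derive_mult (K := C_AbsRing) f g z lf lg Hf Hg Cmult_comm). Qed.

Lemma Cis_derive_const (p z : C) : Cis_derive (fun _ => p) z (RtoC 0).
Proof. apply (is_derive_const (K := C_AbsRing) (V := AbsRing_NormedModule C_AbsRing) p). Qed.

Lemma Cis_derive_minus (f g : C -> C) (z lf lg : C) :
  Cis_derive f z lf -> Cis_derive g z lg ->
  Cis_derive (fun w => f w - g w)%C z (lf - lg)%C.
Proof.
intros Hf Hg.
apply (is_derive_minus (K := C_AbsRing) (V := AbsRing_NormedModule C_AbsRing) f g z lf lg Hf Hg).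
Qed.

Lemma Cis_derive_id (z : C) : Cis_derive (fun w => w) z (RtoC 1).
Proof. apply (is_derive_id (K := C_AbsRing)). Qed.

Lemma Cexp_plus (z w : C) : Cexp (z + w) = (Cexp z * Cexp w)%C.
Proof.
destruct z as [x y], w as [u v]; unfold Cexp, Cplus, Cmult, Re, Im; simpl.
rewrite exp_plus, cos_plus, sin_plus; f_equal; ring.
Qed.

Lemma Rderive_0_eps (f : R -> R) (l : R) : derivable_pt_lim f 0 l ->
  forall eps, 0 < eps -> exists delta, 0 < delta /\ forall x, Rabs x < delta ->
    Rabs (f x - f 0 - l * x) <= eps * Rabs x.
Proof.
intros H eps Heps; destruct (H eps Heps) as [delta Hd].
exists delta; split; [apply cond_pos |]; intros x Hx.
destruct (Req_dec x 0) as [-> | Hx0].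
- replace (f 0 - f 0 - l * 0) with 0 by ring; rewrite Rabs_R0; lra.
- specialize (Hd x Hx0 Hx); rewrite Rplus_0_l in Hd.
  replace (f x - f 0 - l * x) with (((f x - f 0) / x - l) * x) by (field; exact Hx0).
  rewrite Rabs_mult; apply Rmult_le_compat_r; [apply Rabs_pos | lra].
Qed.

Lemma Cexp_linear_at_0 (eps : R) : 0 < eps -> exists delta, 0 < delta /\ forall w,
  Cmod w < delta -> Cmod (Cexp w - 1 - w) <= eps * Cmod w.
Proof.
intros Heps; set (e := Rmin 1 (eps / 8)).
assert (He : 0 < e /\ e <= 1 /\ e <= eps / 8) by (unfold e, Rmin; destruct Rle_dec; lra).
destruct (Rderive_0_eps exp 1 ltac:(rewrite <- exp_0; apply derivable_pt_lim_exp) e ltac:(lra))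
  as [d1 [Hd1 H1]].
assert (Dcos := derivable_pt_lim_cos 0); rewrite sin_0, Ropp_0 in Dcos.
destruct (Rderive_0_eps cos 0 Dcos e ltac:(lra)) as [d2 [Hd2 H2]].
destruct (Rderive_0_eps sin 1 ltac:(rewrite <- cos_0; apply derivable_pt_lim_sin) e ltac:(lra))
  as [d3 [Hd3 H3]].
set (d := Rmin (Rmin d1 e) (Rmin d2 d3)).
assert (Hd : 0 < d /\ d <= d1 /\ d <= d2 /\ d <= d3 /\ d <= e)
  by (unfold d, Rmin; repeat destruct Rle_dec; lra).
exists d; split; [lra |]; intros [a b] Hw.
pose proof (Rmax_Cmod (a, b)) as Hmax; simpl in Hmax.
pose proof (Rmax_l (Rabs a) (Rabs b)); pose proof (Rmax_r (Rabs a) (Rabs b)).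
set (m := Cmod (a, b)) in *.
assert (E1 := H1 a ltac:(lra)); assert (E2 := H2 b ltac:(lra)); assert (E3 := H3 b ltac:(lra)).
rewrite exp_0 in E1; rewrite cos_0 in E2; rewrite sin_0 in E3.
apply Rabs_le_between in E1; apply Rabs_le_between in E2; apply Rabs_le_between in E3.
pose proof (Rabs_pos a); pose proof (Rabs_pos b).
eapply Rle_trans; [apply Cmod_le_sum |].
replace (Re (Cexp (a, b) - 1 - (a, b))%C)
  with ((exp a - 1 - 1 * a) * cos b + (1 + a) * (cos b - 1 - 0 * b))
  by (unfold Cexp, Cminus, Cplus, Copp, Re, Im, RtoC; simpl; ring).
replace (Im (Cexp (a, b) - 1 - (a, b))%C)
  with ((exp a - 1) * sin b + (sin b - 0 - 1 * b))
  by (unfold Cexp, Cminus, Cplus, Copp, Re, Im, RtoC; simpl; ring).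
assert (B1 : Rabs ((exp a - 1 - 1 * a) * cos b) <= e * m).
{ rewrite Rabs_mult; replace (e * m) with (e * m * 1) by ring.
  apply Rmult_le_compat; try apply Rabs_pos; [apply Rabs_le; nra |].
  apply Rabs_le, COS_bound. }
assert (B2 : Rabs ((1 + a) * (cos b - 1 - 0 * b)) <= 2 * (e * m)).
{ rewrite Rabs_mult; apply Rmult_le_compat; try apply Rabs_pos.
  - eapply Rle_trans; [apply Rabs_triang |]; rewrite Rabs_R1; lra.
  - apply Rabs_le; nra. }
assert (B3 : Rabs ((exp a - 1) * sin b) <= 2 * m * (2 * e)).
{ rewrite Rabs_mult; apply Rmult_le_compat; try apply Rabs_pos.
  - replace (exp a - 1) with ((exp a - 1 - 1 * a) + a) by ring.
    eapply Rle_trans; [apply Rabs_triang |].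
    assert (Rabs (exp a - 1 - 1 * a) <= 1 * m) by (apply Rabs_le; nra); lra.
  - replace (sin b) with ((sin b - 0 - 1 * b) + b) by ring.
    eapply Rle_trans; [apply Rabs_triang |].
    assert (Rabs (sin b - 0 - 1 * b) <= 1 * m) by (apply Rabs_le; nra); lra. }
assert (B4 : Rabs (sin b - 0 - 1 * b) <= e * m) by (apply Rabs_le; nra).
pose proof (Rabs_triang ((exp a - 1 - 1 * a) * cos b) ((1 + a) * (cos b - 1 - 0 * b))).
pose proof (Rabs_triang ((exp a - 1) * sin b) (sin b - 0 - 1 * b)).
assert (0 <= m) by apply Cmod_ge_0.
nra.
Qed.

(** The functional equation of [Cexp] carries the expansion at 0 to any point; adding 1 to the
    modulus keeps the divisor positive. *)
Lemma Cis_derive_Cexp_scal (q z : C) : Cis_derive (fun w => Cexp (q * w)) z (q * Cexp (q * z))%C.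
Proof.
assert (H : forall z, Cis_derive Cexp z (Cexp z)).
{ clear; intros z; apply Cis_derive_eps; intros eps Heps.
  assert (Hp : 0 < Cmod (Cexp z) + 1) by (pose proof (Cmod_ge_0 (Cexp z)); lra).
  destruct (Cexp_linear_at_0 (eps / (Cmod (Cexp z) + 1)) ltac:(apply Rdiv_lt_0_compat; lra))
    as [delta [Hd H]].
  exists delta; split; [exact Hd |]; intros w Hw.
  replace w with (z + (w - z))%C at 1 by ring; rewrite Cexp_plus.
  replace (Cexp z * Cexp (w - z) - Cexp z - (w - z) * Cexp z)%C
    with (Cexp z * (Cexp (w - z) - 1 - (w - z)))%C by ring.
  rewrite Cmod_mult.
  apply Rle_trans with ((Cmod (Cexp z) + 1) * (eps / (Cmod (Cexp z) + 1) * Cmod (w - z))).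
  - apply Rmult_le_compat; try apply Cmod_ge_0; [lra | apply H, Hw].
  - right; field; lra. }
apply (is_derive_comp (K := C_AbsRing) (V := AbsRing_NormedModule C_AbsRing) Cexp
  (fun w => q * w)%C z (Cexp (q * z)) q); [apply H |].
assert (Hq := Cis_derive_mult (fun _ => q) (fun w => w) z _ _ (Cis_derive_const q z) (Cis_derive_id z)).
cbv beta in Hq; replace (RtoC 0 * z + q * RtoC 1)%C with q in Hq by ring; exact Hq.
Qed.

Definition Csin (z : C) : C := ((Cexp (Ci * z) - Cexp (- Ci * z)) * / (2 * Ci))%C.

Lemma Csin_pair (x y : R) : Csin (x, y) = (sin x * cosh y, cos x * sinh y).
Proof.
unfold Csin, Cexp, Cminus, Cplus, Copp, Cmult, Cinv, Ci, RtoC, Re, Im, cosh, sinh; simpl.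
replace (0 * x - 1 * y) with (- y) by ring; replace (0 * y + 1 * x) with x by ring.
replace (- 0 * x - - (1) * y) with y by ring; replace (- 0 * y + - (1) * x) with (- x) by ring.
rewrite cos_neg, sin_neg; f_equal; field.
Qed.

Lemma Csin_real (x : R) : Csin (RtoC x) = RtoC (sin x).
Proof.
unfold RtoC; rewrite Csin_pair, cosh_0, sinh_0; f_equal; ring.
Qed.

(** Source of all that is used about |sin|: its zeros are real, it is at least |sinh y|, and it is
    at least 1 on the lines where sin x is 1 or -1. *)
Lemma Cmod_Csin_sqr (x y : R) : Cmod (Csin (x, y)) ^ 2 = sin x ^ 2 + sinh y ^ 2.
Proof.
rewrite Csin_pair, Cmod2_alt; simpl.
pose proof (sin2_cos2 x) as H1; unfold Rsqr in H1.
replace (sin x * cosh y * (sin x * cosh y * 1) + cos x * sinh y * (cos x * sinh y * 1))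
  with (sin x * sin x * cosh y ^ 2 + cos x * cos x * sinh y ^ 2) by ring.
replace (cos x * cos x) with (1 - sin x * sin x) by lra.
rewrite cosh_sqr; ring.
Qed.

Lemma Csin_neq_0 (x y : R) : (y = 0 -> sin x <> 0) -> Csin (x, y) <> 0.
Proof.
intros H E; apply (f_equal (fun z => Cmod z ^ 2)) in E.
rewrite Cmod_Csin_sqr, Cmod_0 in E.
pose proof (pow2_ge_0 (sin x)); pose proof (pow2_ge_0 (sinh y)).
assert (E1 : sin x ^ 2 = 0) by lra; assert (E2 : sinh y ^ 2 = 0) by lra.
assert (Hy : y = 0) by (rewrite <- (arcsinh_sinh y), <- arcsinh_0; f_equal; nra).
apply (H Hy); nra.
Qed.

(** The derivative is left as the product rule produces it. Off the axis only its existence matters;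
    its value at real points is simplified in the next lemma. *)
Lemma Cis_derive_Csin_scal (q z : C) :
  Cis_derive (fun z => Csin (q * z)) z
    (((Ci * q) * Cexp ((Ci * q) * z) - (- Ci * q) * Cexp ((- Ci * q) * z)) * / (2 * Ci)
     + (Cexp ((Ci * q) * z) - Cexp ((- Ci * q) * z)) * RtoC 0)%C.
Proof.
apply (is_derive_ext (K := C_AbsRing) (V := AbsRing_NormedModule C_AbsRing)
  (fun z => (Cexp ((Ci * q) * z) - Cexp ((- Ci * q) * z)) * / (2 * Ci))%C).
- intros w; unfold Csin; rewrite !Cmult_assoc; reflexivity.
- apply (Cis_derive_mult (fun z => Cexp ((Ci * q) * z) - Cexp ((- Ci * q) * z))%C
    (fun _ => / (2 * Ci))%C); [| apply Cis_derive_const].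
  apply (Cis_derive_minus (fun z => Cexp ((Ci * q) * z))
    (fun z => Cexp ((- Ci * q) * z))); apply Cis_derive_Cexp_scal.
Qed.

Lemma Cis_derive_Csin_scal_real (w x : R) :
  Cis_derive (fun z => Csin (RtoC w * z)) (RtoC x) (RtoC (w * cos (w * x))).
Proof.
assert (H := Cis_derive_Csin_scal (RtoC w) (RtoC x)).
rewrite <- !Cmult_assoc, <- RtoC_mult in H.
match type of H with Cis_derive _ _ ?l => replace (RtoC (w * cos (w * x))) with l end; [exact H |].
replace (Cexp (Ci * RtoC (w * x))) with (cos (w * x), sin (w * x)).
2: { unfold Cexp, Ci, Cmult, RtoC, Re, Im; simpl.
  replace (0 * (w * x) - 1 * 0) with 0 by ring.
  replace (0 * 0 + 1 * (w * x)) with (w * x) by ring; rewrite exp_0; f_equal; ring. }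
replace (Cexp (- Ci * RtoC (w * x))) with (cos (w * x), - sin (w * x)).
2: { unfold Cexp, Ci, Copp, Cmult, RtoC, Re, Im; simpl.
  replace (- 0 * (w * x) - - (1) * 0) with 0 by ring.
  replace (- 0 * 0 + - (1) * (w * x)) with (- (w * x)) by ring.
  rewrite exp_0, cos_neg, sin_neg; f_equal; ring. }
unfold Cminus, Cplus, Copp, Cmult, Cinv, Ci, RtoC; simpl; f_equal; field.
Qed.

Lemma Cinv_0 : (/ RtoC 0)%C = 0.
Proof. unfold Cinv, RtoC; simpl; unfold Rdiv; f_equal; ring. Qed.

(** The difference quotient of [D] at [p], completed by the value [l], is a continuous [phi] with (z
    - p) N(z) / D(z) = N(z) / phi(z). The residue is the value of the right side at [p]. *)
Lemma simple_pole_quotient (N D : C -> C) (p : R) (l : C) :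
  Ccontinuous N (RtoC p) -> D (RtoC p) = 0 -> Cis_derive D (RtoC p) l -> l <> 0 ->
  simple_pole (fun z => N z * / D z)%C p (N (RtoC p) * / l)%C.
Proof.
intros HN HD0 HD Hl.
set (phi := fun z => if Ceq_dec z (RtoC p) then l else (D z / (z - RtoC p))%C).
assert (Hphip : phi (RtoC p) = l) by (unfold phi; destruct Ceq_dec; congruence).
assert (Hphi : Ccontinuous phi (RtoC p)).
{ apply Ccontinuous_eps; intros eps Heps.
  destruct (proj1 (Cis_derive_eps D (RtoC p) l) HD (eps / 2) ltac:(lra)) as [delta [Hd H]].
  exists delta; split; [exact Hd |]; intros w Hw; rewrite Hphip.
  unfold phi; destruct Ceq_dec as [_ | Hne].
  - replace (l - l)%C with (RtoC 0) by ring; rewrite Cmod_0; exact Heps.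
  - specialize (H w Hw); rewrite HD0 in H.
    assert (Hwp := Cminus_eq_contra _ _ Hne).
    assert (Hpos := proj1 (Cmod_gt_0 _) Hwp).
    replace (D w / (w - RtoC p) - l)%C
      with ((D w - RtoC 0 - (w - RtoC p) * l) / (w - RtoC p))%C by (field; exact Hwp).
    rewrite Cmod_div by exact Hwp; apply Rlt_div_l; [exact Hpos | nra]. }
assert (Hq : Ccontinuous (fun z => N z * / phi z)%C (RtoC p)).
{ assert (Hi : Ccontinuous (fun z => / phi z)%C (RtoC p)).
  { apply (continuous_comp (U := AbsRing_UniformSpace C_AbsRing)
      (V := AbsRing_UniformSpace C_AbsRing) (W := AbsRing_UniformSpace C_AbsRing) phi Cinv);
      [exact Hphi |].
    apply Cderivable_continuous; eexists; apply Cis_derive_inv; rewrite Hphip; exact Hl. }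
  exact (continuous_mult (U := AbsRing_UniformSpace C_AbsRing) (K := C_AbsRing)
    N (fun z => / phi z)%C (RtoC p) HN Hi). }
intros eps Heps.
destruct (proj1 (Ccontinuous_eps _ _) Hq eps Heps) as [delta [Hd H]].
exists delta; split; [exact Hd |]; intros z Hz Hzd.
specialize (H z Hzd); cbv beta in H; rewrite Hphip in H.
left; replace ((z - RtoC p) * (N z * / D z))%C with (N z * / phi z)%C; [exact H |].
unfold phi; destruct Ceq_dec as [E | _]; [contradiction |].
assert (Hwp := Cminus_eq_contra _ _ Hz).
(* At another zero of [D] both sides are 0 because [/ 0] is [0], so the identity holds there too. *)
destruct (Ceq_dec (D z) 0) as [E | E].
- rewrite E; unfold Cdiv; rewrite Cmult_0_l, Cinv_0; ring.
- field; split; assumption.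
Qed.

(** * The sinc expansion *)

Definition sinc_kernel (F : C -> C) (h x : R) (z : C) : C :=
  (F z * / ((z - RtoC x) * Csin (RtoC (PI / h) * z)))%C.

Lemma sin_IZR_PI (k : Z) : sin (IZR k * PI) = 0.
Proof. apply sin_eq_0_1; exists k; reflexivity. Qed.

Lemma cos_sqr_IZR_PI (k : Z) : cos (IZR k * PI) * cos (IZR k * PI) = 1.
Proof.
pose proof (sin2_cos2 (IZR k * PI)) as H; unfold Rsqr in H; rewrite sin_IZR_PI in H; lra.
Qed.

Lemma sin_lattice_neq_0 (h x : R) : 0 < h -> (forall k, x <> IZR k * h) -> sin (PI / h * x) <> 0.
Proof.
intros Hh Hx E; destruct (sin_eq_0_0 _ E) as [k Hk]; apply (Hx k).
pose proof PI_RGT_0.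
apply Rmult_eq_reg_l with (PI / h); [| apply Rgt_not_eq, Rdiv_lt_0_compat; assumption].
rewrite Hk; field; lra.
Qed.

Lemma Cderivable_sinc_kernel (F : C -> C) (h x u v : R) : 0 < h ->
  Cderivable F (u, v) -> (u, v) <> RtoC x -> (forall k, (u, v) <> RtoC (IZR k * h)) ->
  Cderivable (sinc_kernel F h x) (u, v).
Proof.
intros Hh HF Hx Hk.
assert (Hw : PI / h <> 0) by (apply Rgt_not_eq, Rdiv_lt_0_compat; [apply PI_RGT_0 | exact Hh]).
apply Cderivable_mult; [exact HF |].
apply (Cderivable_inv (fun z => (z - RtoC x) * Csin (RtoC (PI / h) * z))%C).
- apply Cmult_neq_0; [apply Cminus_eq_contra, Hx |].
  replace (RtoC (PI / h) * (u, v))%C with (PI / h * u, PI / h * v)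
    by (unfold Cmult, RtoC; simpl; f_equal; ring).
  apply Csin_neq_0; intros Hv.
  apply Rmult_integral in Hv; destruct Hv as [Hv | Hv]; [contradiction |]; subst v.
  apply sin_lattice_neq_0; [exact Hh |]; intros k E; apply (Hk k); rewrite E; reflexivity.
- apply Cderivable_mult; [apply Cderivable_sub_const |].
  eexists; apply Cis_derive_Csin_scal.
Qed.

(** Covers both kinds of poles. In the derivative of the denominator the first term vanishes at a
    lattice point, the second at p = x. *)
Lemma simple_pole_sinc_kernel (F : C -> C) (h x p : R) :
  Cderivable F (RtoC p) -> (p - x) * sin (PI / h * p) = 0 ->
  sin (PI / h * p) + (p - x) * (PI / h * cos (PI / h * p)) <> 0 ->
  simple_pole (sinc_kernel F h x) p
    (F (RtoC p) * / RtoC (sin (PI / h * p) + (p - x) * (PI / h * cos (PI / h * p))))%C.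
Proof.
intros HF H0 Hl.
apply (simple_pole_quotient F (fun z => (z - RtoC x) * Csin (RtoC (PI / h) * z))%C).
- apply Cderivable_continuous, HF.
- rewrite <- RtoC_mult, Csin_real, <- RtoC_minus, <- RtoC_mult, H0; reflexivity.
- assert (H := Cis_derive_mult (fun z => z - RtoC x)%C (fun z => Csin (RtoC (PI / h) * z))
    (RtoC p) _ _ (Cis_derive_minus _ _ _ _ _ (Cis_derive_id (RtoC p)) (Cis_derive_const (RtoC x) (RtoC p)))
    (Cis_derive_Csin_scal_real (PI / h) p)).
  cbv beta in H.
  rewrite <- RtoC_mult, Csin_real, <- !RtoC_minus, <- !RtoC_mult, <- RtoC_plus in H.
  replace ((1 - 0) * sin (PI / h * p)) with (sin (PI / h * p)) in H by ring; exact H.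
- intros E; apply RtoC_inj in E; contradiction.
Qed.

(** Here cos(k pi) plays the part of (-1)^k. All terms of the sinc sum then share the factor sin(pi
    x / h). *)
Lemma sinc_eq (k : Z) (h x : R) : 0 < h -> x <> IZR k * h ->
  sinc k h x = sin (PI / h * x) * cos (IZR k * PI) / (PI / h * (x - IZR k * h)).
Proof.
intros Hh Hx; unfold sinc; destruct Req_EM_T as [E | _]; [contradiction |].
replace (PI * (x / h - IZR k)) with (PI / h * x - IZR k * PI) at 1 by (field; lra).
rewrite sin_minus, sin_IZR_PI, Rmult_0_r, Rminus_0_r.
f_equal; field; lra.
Qed.

Lemma PI_div_lattice (h : R) (k : Z) : 0 < h -> PI / h * (IZR k * h) = IZR k * PI.
Proof. intros Hh; field; lra. Qed.

(** The rectangle is cut on both sides of [x]: the outer pieces contain only lattice poles, the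
    middle one only [x]. Lattice points are excluded for [x], since there two zeros of the
    denominator would merge. *)
Lemma sinc_contour_formula (F : C -> C) (h c e x a b : R) (j m : Z) :
  0 < h -> c < 0 < e -> a < x < b -> (forall k, x <> IZR k * h) ->
  IZR (j - 1) * h < a < IZR j * h -> IZR m * h < b < IZR (m + 1) * h ->
  (forall u v, a <= u <= b -> c <= v <= e -> Cderivable F (u, v)) ->
  (RtoC (sin (PI / h * x)) * rect_int (sinc_kernel F h x) a b c e
   = 2 * PI * Ci * (F (RtoC x) - sum_Z j m (fun k => F (RtoC (IZR k * h)) * RtoC (sinc k h x))))%C.
Proof.
intros Hh Hce Hx Hxk Ha Hb HF.
set (G := sinc_kernel F h x).
set (r := fun k => (F (RtoC (IZR k * h)) * / RtoC (sin (PI / h * (IZR k * h))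
   + (IZR k * h - x) * (PI / h * cos (PI / h * (IZR k * h)))))%C).
assert (Hsx := sin_lattice_neq_0 h x Hh Hxk).
assert (HFr : forall p, a <= p <= b -> Cderivable F (RtoC p)) by (intros p Hp; apply HF; lra).
pose proof PI_RGT_0 as HPI.
assert (Hr : forall k, (j <= k <= m)%Z -> simple_pole G (IZR k * h) (r k)).
{ intros k [Hk1 Hk2]; apply IZR_le in Hk1, Hk2.
  apply (Rmult_le_compat_r h) in Hk1, Hk2; try lra.
  apply simple_pole_sinc_kernel.
  - apply HFr; lra.
  - rewrite PI_div_lattice, sin_IZR_PI by exact Hh; ring.
  - rewrite PI_div_lattice, sin_IZR_PI, Rplus_0_l by exact Hh.
    pose proof (cos_sqr_IZR_PI k); specialize (Hxk k).
    apply Rmult_integral_contrapositive_currified; [lra |].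
    apply Rmult_integral_contrapositive_currified.
    + apply Rgt_not_eq, Rdiv_lt_0_compat; assumption.
    + intros E; rewrite E in H; lra. }
assert (Hrx : simple_pole G x (F (RtoC x) * / RtoC (sin (PI / h * x)))%C).
{ replace (sin (PI / h * x)) with (sin (PI / h * x) + (x - x) * (PI / h * cos (PI / h * x))) by ring.
  apply simple_pole_sinc_kernel; [apply HFr; lra | ring |].
  replace (x - x) with 0 by ring; rewrite Rmult_0_l, Rplus_0_r; exact Hsx. }
assert (HG : forall u v, a <= u <= b -> c <= v <= e -> (u, v) <> RtoC x ->
  (forall k, (u, v) <> RtoC (IZR k * h)) -> Cderivable G (u, v)).
{ intros u v Hu Hv Hne1 Hne2; apply Cderivable_sinc_kernel; try assumption; apply HF; assumption. }
assert (HGo : forall u v, a <= u <= b -> c <= v <= e -> v <> 0 -> Cderivable G (u, v)).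
{ intros u v Hu Hv Hne; apply HG; try assumption; intros; intros E; injection E; intros; contradiction. }
set (i := Zfloor (x / h)).
assert (Hi : IZR i * h < x < IZR (i + 1) * h).
{ pose proof (Zfloor_bound (x / h)) as [B1 B2]; fold i in B1, B2.
  rewrite plus_IZR; apply (Rmult_le_compat_r h) in B1; [| lra].
  apply (Rmult_lt_compat_r h) in B2; [| lra].
  replace (x / h * h) with x in B1, B2 by (field; lra).
  pose proof (Hxk i); lra. }
assert (Hji : (j - 1 <= i)%Z).
{ assert (IZR (j - 1) * h < IZR (i + 1) * h) as L by lra.
  apply Rmult_lt_reg_r, lt_IZR in L; lia || lra. }
assert (Him : (i <= m)%Z).
{ assert (IZR i * h < IZR (m + 1) * h) as L by lra.
  apply Rmult_lt_reg_r, lt_IZR in L; lia || lra. }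
set (c1 := (Rmax a (IZR i * h) + x) / 2).
set (c2 := (Rmin b (IZR (i + 1) * h) + x) / 2).
assert (Hc1 : a < c1 < x /\ IZR i * h < c1) by (unfold c1, Rmax; destruct Rle_dec; lra).
assert (Hc2 : x < c2 < b /\ c2 < IZR (i + 1) * h) by (unfold c2, Rmin; destruct Rle_dec; lra).
rewrite (rect_int_hsplit G a c1 b)
  by (lra || (intros; split; apply Cderivable_continuous, HGo; lra)).
rewrite (rect_int_hsplit G c1 c2 b)
  by (lra || (intros; split; apply Cderivable_continuous, HGo; lra)).
rewrite (rect_int_lattice_poles G h c e j r Hh Hce i Hji a c1); try lra.
2: { intros u v Hu Hv Hne; apply HG; try lra; [| exact Hne].
  intros E; injection E; intros; lra. }
2: { intros k Hk; apply Hr; lia. }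
rewrite (rect_int_residue G c1 c2 c e x _ ltac:(lra) Hce) with (2 := Hrx).
2: { intros u v Hu Hv Hne; apply HG; try lra; [exact Hne |].
  intros k E; injection E; intros _ E'; apply (lattice_between h i k Hh); lra. }
rewrite (rect_int_lattice_poles G h c e (i + 1) r Hh Hce m ltac:(lia) c2 b); try lra.
2: { replace (i + 1 - 1)%Z with i by lia; lra. }
2: { intros u v Hu Hv Hne; apply HG; try lra; [| exact Hne].
  intros E; injection E; intros; lra. }
2: { intros k Hk; apply Hr; lia. }
assert (Hjm : (j - 1 <= m)%Z) by lia.
(* The residue at k h has k h - x where [sinc] has x - k h, hence the minus sign; cos(k pi) moves
   from denominator to numerator because its square is 1. *)
assert (Hsum : sum_Z j m (fun k => F (RtoC (IZR k * h)) * RtoC (sinc k h x))%C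
  = (- RtoC (sin (PI / h * x)) * (sum_Z j i r + sum_Z (i + 1) m r))%C).
{ rewrite <- sum_Z_split by lia; rewrite sum_Z_scal by exact Hjm; apply sum_Z_ext; [exact Hjm |].
  intros k _; rewrite sinc_eq by (exact Hh || apply Hxk); unfold r.
  rewrite PI_div_lattice, sin_IZR_PI by exact Hh.
  specialize (Hxk k); pose proof (cos_sqr_IZR_PI k) as Hcos.
  set (co := cos (IZR k * PI)) in *.
  assert (Hco : co <> 0) by (intros E; rewrite E in Hcos; lra).
  rewrite Rplus_0_l, <- RtoC_inv, <- RtoC_opp.
  2: { apply Rmult_integral_contrapositive_currified; [lra |].
    apply Rmult_integral_contrapositive_currified; [| exact Hco].
    apply Rgt_not_eq, Rdiv_lt_0_compat; assumption. }
  replace (RtoC (- sin (PI / h * x)) * (F (RtoC (IZR k * h)) * RtoC (/ ((IZR k * h - x) * (PI / h * co)))))%C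
    with (F (RtoC (IZR k * h)) * (RtoC (- sin (PI / h * x)) * RtoC (/ ((IZR k * h - x) * (PI / h * co)))))%C
    by ring.
  rewrite <- RtoC_mult; do 2 f_equal.
  replace (sin (PI / h * x) * co / (PI / h * (x - IZR k * h)))
    with (sin (PI / h * x) * (co * co) / (PI / h * co * (x - IZR k * h)))
    by (field; repeat split; lra).
  rewrite Hcos; field; repeat split; lra. }
rewrite Hsum; field; intros E; apply RtoC_inj in E; contradiction.
Qed.

(** * Bounds for the contour integral *)

Lemma exp_le_compat (x y : R) : x <= y -> exp x <= exp y.
Proof. intros [H | ->]; [left; apply exp_increasing, H | lra]. Qed.

(* The weight [cosh u >= 1] makes the double exponential explicitly integrable. *)
Lemma is_RInt_double_exp (q k a b : R) : k <> 0 ->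
  is_RInt (fun u => q * (cosh u * exp (k * sinh u))) a b
    (q / k * (exp (k * sinh b) - exp (k * sinh a))).
Proof.
intros Hk.
replace (q / k * (exp (k * sinh b) - exp (k * sinh a)))
  with (minus ((fun u => q / k * exp (k * sinh u)) b) ((fun u => q / k * exp (k * sinh u)) a))
  by (unfold minus, plus, opp; simpl; ring).
apply (is_RInt_derive (V := R_CompleteNormedModule) (fun u => q / k * exp (k * sinh u))).
- intros u _; unfold sinh, cosh; auto_derive; [exact I |]; unfold Rminus, Rdiv; field; exact Hk.
- intros u _; unfold sinh, cosh; apply continuity_pt_filterlim; reg.
Qed.

(** Splitting at 0 resolves the absolute value, and each half contributes at most q / k. The bound
    is independent of [a] and [b], so the horizontal sides may grow without limit. *)
Lemma Cmod_CInt_double_exp (f : R -> C) (q k a b : R) : a <= 0 <= b -> 0 <= q -> 0 < k ->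
  ex_CInt f a 0 -> ex_CInt f 0 b ->
  (forall u, a <= u <= b -> Cmod (f u) <= q * exp (- k * Rabs (sinh u))) ->
  Cmod (CInt f a b) <= 2 * q / k.
Proof.
intros Hab Hq Hk Ha Hb Hf.
assert (Hw : forall u, q * exp (- k * Rabs (sinh u)) <= q * (cosh u * exp (- k * Rabs (sinh u)))).
{ intros u; apply Rmult_le_compat_l; [exact Hq |].
  pose proof (cosh_ge_1 u); pose proof (exp_pos (- k * Rabs (sinh u))); nra. }
assert (Hqk : 0 <= q / k) by (apply Rle_mult_inv_pos; assumption).
rewrite (CInt_Chasles f a 0 b Ha Hb).
eapply Rle_trans; [apply Cmod_triangle |].
replace (2 * q / k) with (q / k * 1 + q / k * 1) by (field; lra).
apply Rplus_le_compat.
- eapply Rle_trans.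
  + eapply Cmod_CInt_le; [lra | | exact Ha | apply (is_RInt_double_exp q k a 0); lra].
    intros u Hu; cbv beta; eapply Rle_trans; [apply Hf; lra |].
    eapply Rle_trans; [apply Hw |]; right.
    rewrite Rabs_left1; [do 3 f_equal; ring |].
    pose proof (sinh_ge_0 (- u) ltac:(lra)); rewrite sinh_opp in H; lra.
  + apply Rmult_le_compat_l; [exact Hqk |].
    rewrite sinh_0, Rmult_0_r, exp_0; pose proof (exp_pos (k * sinh a)); lra.
- eapply Rle_trans.
  + eapply Cmod_CInt_le; [lra | | exact Hb | apply (is_RInt_double_exp q (- k) 0 b); lra].
    intros u Hu; cbv beta; eapply Rle_trans; [apply Hf; lra |].
    eapply Rle_trans; [apply Hw |]; right.
    rewrite Rabs_pos_eq; [reflexivity | apply sinh_ge_0; lra].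
  + replace (q / - k * (exp (- k * sinh b) - exp (- k * sinh 0)))
      with (q / k * (exp (- k * sinh 0) - exp (- k * sinh b))) by (field; lra).
    apply Rmult_le_compat_l; [exact Hqk |].
    rewrite sinh_0, Rmult_0_r, exp_0; pose proof (exp_pos (- k * sinh b)); lra.
Qed.

Lemma sum_Z_single (a b i : Z) (g : Z -> C) : (a <= i <= b)%Z ->
  (forall k, k <> i -> g k = RtoC 0) -> sum_Z a b g = g i.
Proof.
intros Hi Hg.
assert (H0 : forall c d, (c - 1 <= d)%Z -> (d < i \/ i < c)%Z -> sum_Z c d g = RtoC 0).
{ intros c d Hcd; pattern d; apply (Z_ind_from c); [| | exact Hcd].
  - intros _; apply sum_Z_empty.
  - intros k Hk IH Hd; rewrite sum_Z_succ, IH, Hg by lia; ring. }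
rewrite (sum_Z_split a i b) by lia.
replace i with (i - 1 + 1)%Z at 1 by lia; rewrite sum_Z_succ, !H0 by lia.
replace (i - 1 + 1)%Z with i by lia; ring.
Qed.

Lemma sinc_lattice (i k : Z) (h : R) : 0 < h ->
  sinc k h (IZR i * h) = if Z.eq_dec k i then 1 else 0.
Proof.
intros Hh; destruct (Z.eq_dec k i) as [-> | Hne].
- unfold sinc; destruct Req_EM_T; [reflexivity | contradiction].
- rewrite sinc_eq; [| exact Hh |].
  + rewrite PI_div_lattice, sin_IZR_PI by exact Hh; unfold Rdiv; ring.
  + intros E; apply Rmult_eq_reg_r in E; [| lra]; apply eq_IZR in E; congruence.
Qed.

Lemma Cmod_sinc_kernel_le (F : C -> C) (h x u v D S B : R) : 0 < D -> 0 < S -> 0 <= B ->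
  Cmod (F (u, v)) <= B -> D <= Cmod ((u, v) - RtoC x) ->
  S <= Cmod (Csin (PI / h * u, PI / h * v)) ->
  Cmod (sinc_kernel F h x (u, v)) <= B / (D * S).
Proof.
intros HD HS HB HF Hx Hs; unfold sinc_kernel.
replace (RtoC (PI / h) * (u, v))%C with (PI / h * u, PI / h * v)
  by (unfold Cmult, RtoC; simpl; f_equal; ring).
assert (N1 : ((u, v) - RtoC x)%C <> RtoC 0) by (apply Cmod_gt_0; lra).
assert (N2 : Csin (PI / h * u, PI / h * v) <> RtoC 0) by (apply Cmod_gt_0; lra).
rewrite Cmod_mult, Cmod_inv, Cmod_mult by (apply Cmult_neq_0; assumption).
apply Rmult_le_compat; try apply Cmod_ge_0; [| exact HF |].
- left; apply Rinv_0_lt_compat, Rmult_lt_0_compat; lra.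
- apply Rinv_le_contravar; [apply Rmult_lt_0_compat; lra |].
  apply Rmult_le_compat; lra.
Qed.

Lemma Rabs_le_Cmod_im (x y : R) : Rabs y <= Cmod (x, y).
Proof. eapply Rle_trans; [| apply Rmax_Cmod]; apply Rmax_r. Qed.

Lemma Rabs_le_Cmod_re (x y : R) : Rabs x <= Cmod (x, y).
Proof. eapply Rle_trans; [| apply Rmax_Cmod]; apply Rmax_l. Qed.

Lemma sqr_le_inv (x y : R) : 0 <= y -> x ^ 2 <= y ^ 2 -> x <= y.
Proof. intros Hy H; destruct (Rle_or_lt x y) as [L | L]; [exact L | nra]. Qed.

Lemma Rabs_sinh_le_Cmod_Csin (x y : R) : Rabs (sinh y) <= Cmod (Csin (x, y)).
Proof.
apply sqr_le_inv; [apply Cmod_ge_0 |].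
rewrite pow2_abs, Cmod_Csin_sqr; pose proof (pow2_ge_0 (sin x)); lra.
Qed.

Lemma one_le_Cmod_Csin (k : Z) (y : R) : 1 <= Cmod (Csin ((IZR k + / 2) * PI, y)).
Proof.
apply sqr_le_inv; [apply Cmod_ge_0 |].
rewrite Cmod_Csin_sqr.
replace ((IZR k + / 2) * PI) with (PI / 2 + IZR k * PI) by field.
rewrite sin_plus, sin_PI2, cos_PI2; pose proof (cos_sqr_IZR_PI k); pose proof (pow2_ge_0 (sinh y)).
nra.
Qed.

Section SincExpansion.

Variables (F : C -> C) (h s B k : R).
Hypothesis h_pos : 0 < h.
Hypothesis s_pos : 0 < s.
Hypothesis B_pos : 0 <= B.
Hypothesis k_pos : 0 < k.
Hypothesis F_derivable : forall u v, - s <= v <= s -> Cderivable F (u, v).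
Hypothesis F_decay : forall u v, - s <= v <= s -> Cmod (F (u, v)) <= B * exp (- k * Rabs (sinh u)).

Lemma Cmod_F_le (u v : R) : - s <= v <= s -> Cmod (F (u, v)) <= B.
Proof.
intros Hv; eapply Rle_trans; [apply F_decay, Hv |].
rewrite <- (Rmult_1_r B) at 2; apply Rmult_le_compat_l; [exact B_pos |].
rewrite <- exp_0; apply exp_le_compat.
pose proof (Rabs_pos (sinh u)); nra.
Qed.

(** The first term collects the two horizontal sides, the second the two vertical ones; 2 pi is the
    modulus of 2 pi i, and |sin(pi x / h)| <= 1. *)
Lemma sinc_sum_error (x : R) (L : Z) : (0 <= L)%Z -> Rabs x < IZR L * h ->
  Cmod (F (RtoC x) - sum_Z (- L) L (fun i => F (RtoC (IZR i * h)) * RtoC (sinc i h x)))%C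
  <= (2 * (2 * (B / (s * sinh (PI / h * s))) / k) + 2 * (2 * s * (B / (IZR L * h - Rabs x)))) / (2 * PI).
Proof.
intros HL Hx.
pose proof PI_RGT_0 as HPI.
assert (HPIh : 0 < PI / h) by (apply Rdiv_lt_0_compat; assumption).
assert (Hsinh : 0 < sinh (PI / h * s)) by (apply sinh_gt_0, Rmult_lt_0_compat; assumption).
assert (HLx : 0 < IZR L * h - Rabs x) by lra.
assert (Hq : 0 <= B / (s * sinh (PI / h * s)))
  by (apply Rle_mult_inv_pos; [exact B_pos | apply Rmult_lt_0_compat; assumption]).
assert (Hv0 : 0 <= B / (IZR L * h - Rabs x)) by (apply Rle_mult_inv_pos; assumption).
destruct (Classical_Prop.classic (forall i, x <> IZR i * h)) as [Hxi | Hxi].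
2: { apply Classical_Pred_Type.not_all_not_ex in Hxi; destruct Hxi as [i ->].
  rewrite (sum_Z_single (- L) L i).
  - rewrite sinc_lattice by exact h_pos; destruct Z.eq_dec; [| contradiction].
    replace (F (RtoC (IZR i * h)) - F (RtoC (IZR i * h)) * RtoC 1)%C with (RtoC 0) by ring.
    rewrite Cmod_0; apply Rle_mult_inv_pos; [| lra].
    apply Rplus_le_le_0_compat; apply Rmult_le_pos; try lra.
    + apply Rle_mult_inv_pos; lra.
    + apply Rmult_le_pos; lra.
  - assert (Hb : - (IZR L * h) < IZR i * h < IZR L * h) by (apply Rabs_lt_between in Hx; lra).
    rewrite Ropp_mult_distr_l, <- opp_IZR in Hb; destruct Hb as [H1 H2].
    apply Rmult_lt_reg_r in H1, H2; try exact h_pos; apply lt_IZR in H1, H2; lia.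
  - intros j Hj; rewrite sinc_lattice by exact h_pos; destruct Z.eq_dec; [contradiction |].
    ring. }
assert (Hxb := proj1 (Rabs_lt_between _ _) Hx).
(* Halfway between lattice points the vertical sides avoid all poles and satisfy |sin| >= 1. *)
set (A := (IZR L + / 2) * h).
assert (HA : A = IZR L * h + h / 2) by (unfold A; field).
assert (HL0 : 0 <= IZR L * h) by (apply Rmult_le_pos; [apply IZR_le, HL | lra]).
assert (Hf := sinc_contour_formula F h (- s) s x (- A) A (- L) L h_pos ltac:(lra) ltac:(lra) Hxi).
rewrite minus_IZR, plus_IZR, opp_IZR in Hf.
specialize (Hf ltac:(lra) ltac:(lra) ltac:(intros; apply F_derivable; assumption)).
set (E := (F (RtoC x) - sum_Z (- L) L (fun i => F (RtoC (IZR i * h)) * RtoC (sinc i h x)))%C) in *.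
assert (Hlow_re : forall y, IZR L * h - Rabs x <= Cmod ((A, y) - RtoC x)).
{ intros y; eapply Rle_trans; [| apply Rabs_le_Cmod_re]; simpl.
  eapply Rle_trans; [| apply Rle_abs]; pose proof (Rle_abs x); lra. }
assert (Hlow_re' : forall y, IZR L * h - Rabs x <= Cmod (((- A)%R, y) - RtoC x)).
{ intros y; eapply Rle_trans; [| apply Rabs_le_Cmod_re]; simpl.
  rewrite <- (Rabs_Ropp (- A + - x)); eapply Rle_trans; [| apply Rle_abs].
  pose proof (Rle_abs (- x)); rewrite Rabs_Ropp in H; lra. }
assert (Hcont : forall u v, - A <= u <= A -> - s <= v <= s -> v <> 0 \/ u = A \/ u = - A ->
  Ccontinuous (sinc_kernel F h x) (u, v)).
{ intros u v Hu Hv Huv; apply Cderivable_continuous, Cderivable_sinc_kernel; try assumption.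
  - apply F_derivable, Hv.
  - intros E'; injection E'; intros; lra.
  - intros i E'; injection E'; intros E1 E2; destruct Huv as [Hn | Huv]; [contradiction |].
    (* Doubling turns the equality of a half-integer and an integer into one of an odd and an even
       integer. *)
    apply (f_equal (fun t => t * 2 / h)) in E2.
    replace (IZR i * h * 2 / h) with (IZR (i * 2)) in E2 by (rewrite mult_IZR; field; lra).
    destruct Huv as [-> | ->]; unfold A in E2.
    + replace ((IZR L + / 2) * h * 2 / h) with (IZR (L * 2 + 1)) in E2
        by (rewrite plus_IZR, mult_IZR; field; lra).
      apply eq_IZR in E2; lia.
    + replace (- ((IZR L + / 2) * h) * 2 / h) with (IZR (- (L * 2 + 1))) in E2
        by (rewrite opp_IZR, plus_IZR, mult_IZR; field; lra).
      apply eq_IZR in E2; lia. }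
assert (Hline : forall v, v = s \/ v = - s ->
  Cmod (CInt (fun u => sinc_kernel F h x (u, v)) (- A) A) <= 2 * (B / (s * sinh (PI / h * s))) / k).
{ intros v Hv; apply Cmod_CInt_double_exp; try assumption; try lra.
  - apply ex_CInt_hline; [lra |]; intros; apply Hcont; lra.
  - apply ex_CInt_hline; [lra |]; intros; apply Hcont; lra.
  - intros u Hu.
    replace (B / (s * sinh (PI / h * s)) * exp (- k * Rabs (sinh u)))
      with (B * exp (- k * Rabs (sinh u)) / (s * sinh (PI / h * s))) by (field; lra).
    apply Cmod_sinc_kernel_le; try assumption.
    + apply Rmult_le_pos; [exact B_pos | left; apply exp_pos].
    + apply F_decay; lra.
    + eapply Rle_trans; [| apply Rabs_le_Cmod_im]; simpl.
      unfold Rabs; destruct Rcase_abs; lra.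
    + eapply Rle_trans; [| apply Rabs_sinh_le_Cmod_Csin].
      destruct Hv as [-> | ->]; [apply Rle_abs |].
      rewrite <- Ropp_mult_distr_r, sinh_opp, Rabs_Ropp; apply Rle_abs. }
assert (Hside : forall u, u = A \/ u = - A ->
  Cmod (CInt (fun v => sinc_kernel F h x (u, v)) (- s) s) <= 2 * s * (B / (IZR L * h - Rabs x))).
{ intros u Hu; replace (2 * s) with (s - - s) by ring.
  apply Cmod_CInt_le_const; [lra | |].
  - intros v Hv; replace (IZR L * h - Rabs x) with ((IZR L * h - Rabs x) * 1) by ring.
    apply Cmod_sinc_kernel_le; try assumption; try lra.
    + apply Cmod_F_le, Hv.
    + destruct Hu as [-> | ->]; [apply Hlow_re | apply Hlow_re'].
    + destruct Hu as [-> | ->]; unfold A.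
      * replace (PI / h * ((IZR L + / 2) * h)) with ((IZR L + / 2) * PI) by (field; lra).
        apply one_le_Cmod_Csin.
      (* The left side is again of the form integer plus 1/2, with integer - L - 1. *)
      * replace (PI / h * - ((IZR L + / 2) * h)) with ((IZR (- L - 1) + / 2) * PI)
          by (rewrite minus_IZR, opp_IZR; field; lra).
        apply one_le_Cmod_Csin.
  - apply ex_CInt_vline; [lra |]; intros; apply Hcont; lra. }
assert (Hrect : Cmod (rect_int (sinc_kernel F h x) (- A) A (- s) s)
   <= 2 * (2 * (B / (s * sinh (PI / h * s))) / k) + 2 * (2 * s * (B / (IZR L * h - Rabs x)))).
{ eapply Rle_trans; [apply (Cmod_rect_int_le _ _ _ _ _ _ _ _ _ (Hline (- s) ltac:(lra))
    (Hline s ltac:(lra)) (Hside (- A) ltac:(lra)) (Hside A ltac:(lra))) |].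
  lra. }
apply (f_equal Cmod) in Hf.
rewrite !Cmod_mult, Cmod_Ci, !Cmod_R, (Rabs_pos_eq 2), (Rabs_pos_eq PI) in Hf by lra.
apply Rle_div_r; [lra |].
replace (Cmod E * (2 * PI)) with (2 * PI * 1 * Cmod E) by ring; rewrite <- Hf.
eapply Rle_trans; [| exact Hrect].
rewrite <- Rmult_1_l; apply Rmult_le_compat_r; [apply Cmod_ge_0 |].
apply Rabs_le, SIN_bound.
Qed.

Lemma sinc_series_error (x eps : R) : 0 < eps -> exists L0 : Z, forall L, (L0 <= L)%Z ->
  Cmod (F (RtoC x) - sum_Z (- L) L (fun i => F (RtoC (IZR i * h)) * RtoC (sinc i h x)))%C
  <= 2 * B / (PI * k * s * sinh (PI / h * s)) + eps.
Proof.
intros Heps; pose proof PI_RGT_0 as HPI.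
(* Chosen so that L h - |x| is at least 2 s B / (pi eps), which brings the vertical sides below
   [eps]. The summand 1 keeps that distance positive even if [B = 0]. *)
set (y := (Rabs x + 1 + 2 * s * B / (PI * eps)) / h).
exists (Z.max 0 (up y)); intros L HL.
assert (Hy : y <= IZR L).
{ destruct (archimed y) as [H1 _]; assert (H2 : IZR (up y) <= IZR L) by (apply IZR_le; lia); lra. }
apply (Rmult_le_compat_r h) in Hy; [| lra].
replace (y * h) with (Rabs x + 1 + 2 * s * B / (PI * eps)) in Hy by (unfold y; field; lra).
assert (Ht : 0 <= 2 * s * B / (PI * eps)).
{ apply Rle_mult_inv_pos; [apply Rmult_le_pos; lra | apply Rmult_lt_0_compat; assumption]. }
assert (HPIh : 0 < PI / h) by (apply Rdiv_lt_0_compat; assumption).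
assert (Hsinh : 0 < sinh (PI / h * s)) by (apply sinh_gt_0, Rmult_lt_0_compat; assumption).
eapply Rle_trans; [apply sinc_sum_error; [lia | lra] |].
assert (HD : 0 < IZR L * h - Rabs x) by lra.
set (D := IZR L * h - Rabs x) in *.
replace ((2 * (2 * (B / (s * sinh (PI / h * s))) / k) + 2 * (2 * s * (B / D))) / (2 * PI))
  with (2 * B / (PI * k * s * sinh (PI / h * s)) + 2 * s * B / PI / D)
  by (field; repeat split; lra).
apply Rplus_le_compat_l; apply Rle_div_l; [exact HD |].
apply Rle_trans with (eps * (2 * s * B / (PI * eps))); [right; field; lra |].
apply Rmult_le_compat_l; unfold D; lra.
Qed.

End SincExpansion.

(** * The double exponential decay of E_1 *)

Lemma Rabs_sin_le (t : R) : Rabs (sin t) <= Rabs t.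
Proof.
assert (H : forall u, 0 <= u -> Rabs (sin u) <= u).
{ intros u [Hu | <-]; [| rewrite sin_0, Rabs_R0; lra].
  apply Rabs_le; split; [| left; apply sin_lt_x, Hu].
  destruct (Rle_or_lt 1 u); [pose proof (SIN_bound u); lra |].
  pose proof PI2_3_2; assert (0 <= sin u) by (apply sin_ge_0; lra); lra. }
destruct (Rle_or_lt 0 t) as [L | L].
- rewrite (Rabs_pos_eq t) by exact L; apply H, L.
- rewrite (Rabs_left t) by exact L; rewrite <- Rabs_Ropp, <- sin_neg; apply H; lra.
Qed.

Lemma Csinh_pair (x y : R) : Csinh (x, y) = (sinh x * cos y, cosh x * sin y).
Proof.
unfold Csinh, Cexp, Cdiv, Cminus, Cplus, Copp, Cmult, Cinv, RtoC, Re, Im, cosh, sinh; simpl.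
rewrite cos_neg, sin_neg; f_equal; field.
Qed.

Lemma psiC_pair (x y : R) :
  psiC (x, y) = Csinh (PI / 2 * sinh x * cos y, PI / 2 * cosh x * sin y).
Proof.
unfold psiC; rewrite (Csinh_pair x y); f_equal.
unfold Cmult, RtoC; simpl; f_equal; ring.
Qed.

(** The auxiliary [w] is cosh(a + ib), and 1 + sinh^2 = cosh^2 turns the left side into |w|^2. *)
Lemma Cmod_one_add_Csinh_sqr (a b : R) :
  Cmod (1 + Csinh (a, b) * Csinh (a, b)) = cosh a ^ 2 - sin b ^ 2.
Proof.
rewrite Csinh_pair.
pose proof (cosh_sqr a) as H1; pose proof (sin2_cos2 b) as H2; unfold Rsqr in H2.
set (z := (sinh a * cos b, cosh a * sin b)); set (w := (cosh a * cos b, sinh a * sin b)).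
replace (1 + z * z)%C with (w * w)%C.
- rewrite Cmod_mult.
  replace (Cmod w * Cmod w) with (Cmod w ^ 2) by ring.
  rewrite Cmod2_alt; unfold w; simpl.
  replace (sin b * (sin b * 1)) with (sin b * sin b) by ring.
  replace (sinh a * sin b * (sinh a * sin b * 1)) with (sinh a ^ 2 * (sin b * sin b)) by ring.
  replace (cosh a * cos b * (cosh a * cos b * 1)) with (cosh a ^ 2 * (cos b * cos b)) by ring.
  replace (cos b * cos b) with (1 - sin b * sin b) by lra.
  replace (cosh a * (cosh a * 1)) with (cosh a ^ 2) by ring.
  rewrite H1; ring.
- unfold w, z, Cplus, Cmult, RtoC; simpl; f_equal; [| ring].
  replace (cosh a * cos b * (cosh a * cos b)) with (cosh a ^ 2 * (cos b * cos b)) by ring.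
  replace (cosh a * sin b * (cosh a * sin b)) with (cosh a ^ 2 * (sin b * sin b)) by ring.
  replace (cos b * cos b) with (1 - sin b * sin b) by lra.
  replace (sinh a * cos b * (sinh a * cos b)) with (sinh a ^ 2 * (cos b * cos b)) by ring.
  replace (cos b * cos b) with (1 - sin b * sin b) by lra.
  rewrite H1; ring.
Qed.

Lemma sinh_ge_id (t : R) : 0 <= t -> t <= sinh t.
Proof.
intros Ht; destruct (MVT_gen (fun u => sinh u - u) 0 t (fun u => cosh u - 1)) as [c [_ Hc]].
- intros u _; unfold sinh, cosh; auto_derive; [exact I |]; unfold Rminus, Rdiv; field.
- intros u _; unfold sinh; reg.
- rewrite sinh_0 in Hc; pose proof (cosh_ge_1 c); nra.
Qed.

(** From cosh t = 1 + 2 sinh(t / 2)^2 and sinh u >= u for u >= 0, then by evenness. *)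
Lemma cosh_ge_quadratic (a : R) : 1 + a ^ 2 / 2 <= cosh a.
Proof.
assert (H : forall t, 0 <= t -> 1 + t ^ 2 / 2 <= cosh t).
{ intros t Ht.
  assert (E : cosh t = 1 + 2 * sinh (t / 2) ^ 2).
  { assert (E1 : exp t = exp (t / 2) * exp (t / 2)) by (rewrite <- exp_plus; f_equal; field).
    assert (E2 : exp (- t) = exp (- (t / 2)) * exp (- (t / 2)))
      by (rewrite <- exp_plus; f_equal; field).
    assert (E3 : exp (t / 2) * exp (- (t / 2)) = 1)
      by (rewrite <- exp_plus, Rplus_opp_r; apply exp_0).
    unfold cosh, sinh; rewrite E1, E2; set (u := exp (t / 2)) in *; set (v := exp (- (t / 2))) in *.
    replace 1 with (u * v); field. }
  rewrite E; pose proof (sinh_ge_id (t / 2) ltac:(lra)); nra. }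
destruct (Rle_or_lt 0 a) as [L | L]; [apply H, L |].
rewrite <- cosh_opp; replace (a ^ 2) with ((- a) ^ 2) by ring; apply H; lra.
Qed.

Lemma sin_ge_cubic (c : R) : 0 <= c <= PI -> c - c ^ 3 / 6 <= sin c.
Proof.
intros Hc; destruct (sin_bound c 0 (proj1 Hc) (proj2 Hc)) as [H _].
eapply Rle_trans; [| exact H].
unfold sin_approx, sin_term; simpl; right; field.
Qed.

(** Factor the difference of squares: cos c <= pi/2 - c handles one factor and c <= (pi/2 + c) sin c
    the other. It is the comparison of first-order terms in u = cosh x - 1 behind the key
    inequality. *)
Lemma mul_cos_le (c : R) : 0 <= c <= PI / 2 -> c * cos c <= ((PI / 2) ^ 2 - c ^ 2) * sin c.
Proof.
intros Hc; pose proof PI_RGT_0 as P0; pose proof PI_4 as P4; pose proof PI2_3_2 as P3.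
assert (H1 : cos c <= PI / 2 - c).
{ rewrite <- sin_shift; destruct (Req_dec c (PI / 2)) as [-> | Hne].
  - rewrite Rminus_diag, sin_0; lra.
  - left; apply sin_lt_x; lra. }
assert (H2 : c <= (PI / 2 + c) * sin c).
{ apply Rle_trans with ((PI / 2 + c) * (c - c ^ 3 / 6)).
  (* Replacing pi/2 by 3/2 leaves a polynomial inequality, which holds for c <= 2 and hence on the
     whole range since pi <= 4. *)
  - apply Rle_trans with ((3 / 2 + c) * (c - c ^ 3 / 6)).
    + assert (0 <= c * (1 / 2 + c - c ^ 2 / 4 - c ^ 3 / 6)); [| nra].
      apply Rmult_le_pos; [lra |].
      assert (c ^ 2 <= 2 * c) by nra; assert (c ^ 3 <= 4 * c) by nra; lra.
    + apply Rmult_le_compat_r; [| lra].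
      replace (c - c ^ 3 / 6) with (c * (1 - c ^ 2 / 6)) by field.
      apply Rmult_le_pos; [lra | nra].
  - apply Rmult_le_compat_l; [lra | apply sin_ge_cubic; lra]. }
replace ((PI / 2) ^ 2 - c ^ 2) with ((PI / 2 - c) * (PI / 2 + c)) by ring.
apply Rle_trans with (c * (PI / 2 - c)); [apply Rmult_le_compat_l; lra |].
rewrite Rmult_assoc, Rmult_comm; apply Rmult_le_compat_l; lra.
Qed.

Lemma Rabs_sin_dilation_le (c u : R) : 0 <= c <= PI / 2 -> 0 <= u ->
  Rabs (sin (c + c * u)) <= sin c + c * u * cos c.
Proof.
intros Hc Hu; rewrite sin_plus.
assert (Hs : 0 <= sin c) by (apply sin_ge_0; lra).
assert (Hcos : 0 <= cos c) by (apply cos_ge_0; lra).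
assert (Hcu : 0 <= c * u) by (apply Rmult_le_pos; lra).
eapply Rle_trans; [apply Rabs_triang |].
rewrite !Rabs_mult, (Rabs_pos_eq (sin c)), (Rabs_pos_eq (cos c)) by assumption.
apply Rplus_le_compat.
- rewrite <- (Rmult_1_r (sin c)) at 2; apply Rmult_le_compat_l; [exact Hs | apply Rabs_le, COS_bound].
- rewrite Rmult_comm; apply Rmult_le_compat_r; [exact Hcos |].
  rewrite <- (Rabs_pos_eq (c * u)) at 2 by exact Hcu; apply Rabs_sin_le.
Qed.

(* With [u = cosh x - 1] and [c = (pi/2) sin y], the argument of the sine is [c (1 + u)],
   while [cosh >= 1 + (.)^2/2] gives the right-hand side growth at least [(pi^2/4 - c^2) u sin c]. *)
Lemma Rabs_sin_le_cosh_mul_sin (x y : R) : 0 <= y < PI / 2 ->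
  Rabs (sin (PI / 2 * cosh x * sin y))
  <= cosh (PI / 2 * sinh x * cos y) * sin (PI / 2 * sin y).
Proof.
intros Hy; pose proof PI_RGT_0 as HPI.
assert (Hsy : 0 <= sin y <= 1) by (split; [apply sin_ge_0; lra | apply SIN_bound]).
set (c := PI / 2 * sin y).
assert (Hc : 0 <= c <= PI / 2) by (unfold c; nra).
set (u := cosh x - 1).
assert (Hu : 0 <= u) by (unfold u; pose proof (cosh_ge_1 x); lra).
replace (PI / 2 * cosh x * sin y) with (c + c * u) by (unfold c, u; ring).
eapply Rle_trans; [apply Rabs_sin_dilation_le; assumption |].
assert (Hs : 0 <= sin c) by (apply sin_ge_0; lra).
assert (Ha : (PI / 2 * sinh x * cos y) ^ 2 = ((PI / 2) ^ 2 - c ^ 2) * (u * (u + 2))).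
{ pose proof (cosh_sqr x) as H1; pose proof (sin2_cos2 y) as H2; unfold Rsqr in H2.
  replace (u * (u + 2)) with (sinh x ^ 2) by (unfold u; lra).
  unfold c; replace ((PI / 2 * sinh x * cos y) ^ 2)
    with ((PI / 2) ^ 2 * sinh x ^ 2 * (cos y * cos y)) by ring.
  replace (cos y * cos y) with (1 - sin y * sin y) by lra; ring. }
pose proof (cosh_ge_quadratic (PI / 2 * sinh x * cos y)) as Hq; rewrite Ha in Hq.
apply Rle_trans with ((1 + ((PI / 2) ^ 2 - c ^ 2) * (u * (u + 2)) / 2) * sin c);
  [| apply Rmult_le_compat_r; assumption].
pose proof (mul_cos_le c Hc) as Hm.
assert (H0 : 0 <= ((PI / 2) ^ 2 - c ^ 2) * sin c) by (apply Rmult_le_pos; nra).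
apply (Rmult_le_compat_r u) in Hm; [| exact Hu].
assert (H3 : 0 <= (((PI / 2) ^ 2 - c ^ 2) * sin c) * (u * u)) by (apply Rmult_le_pos; nra).
nra.
Qed.

(** With a = (pi/2) sinh x cos y and b = (pi/2) cosh x sin y, bounding |sin b| by cosh a times
    |sin((pi/2) sin y)| in cosh a ^ 2 - sin b ^ 2 leaves cosh a ^ 2 times a squared cosine. Negative
    [y] follows by oddness. *)
Lemma cosh_mul_cos_sqr_le (x y : R) : Rabs y < PI / 2 ->
  (cosh (PI / 2 * sinh x * cos y) * cos (PI / 2 * sin y)) ^ 2
  <= Cmod (1 + psiC (x, y) * psiC (x, y)).
Proof.
intros Hy; rewrite psiC_pair, Cmod_one_add_Csinh_sqr.
assert (H : sin (PI / 2 * cosh x * sin y) ^ 2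
   <= (cosh (PI / 2 * sinh x * cos y) * sin (PI / 2 * sin y)) ^ 2).
{ destruct (Rle_or_lt 0 y) as [L | L].
  - rewrite Rabs_pos_eq in Hy by exact L.
    rewrite <- (pow2_abs (sin _)); apply pow_incr; split; [apply Rabs_pos |].
    apply Rabs_sin_le_cosh_mul_sin; lra.
  - rewrite Rabs_left in Hy by exact L.
    pose proof (Rabs_sin_le_cosh_mul_sin x (- y) ltac:(lra)) as H.
    rewrite sin_neg, cos_neg, <- !Ropp_mult_distr_r, !sin_neg, Rabs_Ropp in H.
    rewrite <- (pow2_abs (sin _)).
    replace ((cosh (PI / 2 * sinh x * cos y) * sin (PI / 2 * sin y)) ^ 2)
      with ((- (cosh (PI / 2 * sinh x * cos y) * sin (PI / 2 * sin y))) ^ 2) by ring.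
    apply pow_incr; split; [apply Rabs_pos | lra]. }
rewrite Rpow_mult_distr in H |- *.
pose proof (sin2_cos2 (PI / 2 * sin y)) as H2; unfold Rsqr in H2.
replace (cos (PI / 2 * sin y) ^ 2) with (1 - sin (PI / 2 * sin y) ^ 2) by lra.
lra.
Qed.

Lemma cosh_ge_half_exp (a : R) : exp (Rabs a) / 2 <= cosh a.
Proof.
unfold cosh; pose proof (exp_pos a); pose proof (exp_pos (- a)).
unfold Rabs; destruct Rcase_abs; lra.
Qed.

Lemma cos_half_PI_sin_gt_0 (y : R) : Rabs y < PI / 2 -> 0 < cos (PI / 2 * sin y).
Proof.
intros Hy; apply Rabs_lt_between in Hy; pose proof PI_RGT_0.
assert (H1 : sin y < 1) by (rewrite <- sin_PI2; apply sin_increasing_1; lra).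
assert (H2 : -1 < sin y)
  by (replace (-1) with (sin (- (PI / 2))) by (rewrite sin_neg, sin_PI2; ring); apply sin_increasing_1; lra).
apply cos_gt_0; nra.
Qed.

(** The base of the power is at least Y^2 with Y = q e^|a| / 2, and the negative exponent reverses
    the inequality. The comparison is made on logarithms, through which [Rpower] is defined. *)
Lemma abs_E1_psiC_le (g x y : R) : 0 < g -> Rabs y < PI / 2 ->
  abs_E1 g (psiC (x, y))
  <= exp (- (g * (PI / 2 * cos y)) * Rabs (sinh x)) * Rpower (2 / cos (PI / 2 * sin y)) g.
Proof.
intros Hg Hy; assert (Hq := cos_half_PI_sin_gt_0 y Hy).
set (q := cos (PI / 2 * sin y)) in *.
set (a := PI / 2 * sinh x * cos y).
pose proof PI_RGT_0 as HPI.
assert (Hcos : 0 < cos y) by (apply Rabs_lt_between in Hy; apply cos_gt_0; lra).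
assert (Ha : Rabs a = PI / 2 * cos y * Rabs (sinh x)).
{ unfold a; rewrite !Rabs_mult, (Rabs_pos_eq (PI / 2)), (Rabs_pos_eq (cos y)) by lra; ring. }
set (Y := exp (Rabs a) / 2 * q).
assert (HY : 0 < Y) by (unfold Y; pose proof (exp_pos (Rabs a)); apply Rmult_lt_0_compat; lra).
assert (HX : Y ^ 2 <= Cmod (1 + psiC (x, y) * psiC (x, y))).
{ eapply Rle_trans; [| apply cosh_mul_cos_sqr_le, Hy]; fold q a.
  apply pow_incr; split; [lra |]; unfold Y.
  apply Rmult_le_compat_r; [lra | apply cosh_ge_half_exp]. }
assert (HlnY : ln Y = Rabs a - ln (2 / q)).
{ unfold Y; rewrite ln_mult, ln_div, ln_div, ln_exp by (try apply exp_pos; try lra;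
    pose proof (exp_pos (Rabs a)); lra); ring. }
unfold abs_E1; apply Rle_trans with (Rpower (Y ^ 2) (- g / 2)).
- unfold Rpower; apply exp_le_compat.
  assert (ln (Y ^ 2) <= ln (Cmod (1 + psiC (x, y) * psiC (x, y))));
    [apply ln_le; [apply pow_lt, HY | exact HX] | nra].
- right; unfold Rpower; rewrite <- exp_plus; f_equal.
  replace (Y ^ 2) with (Y * Y) by ring; rewrite ln_mult, HlnY, Ha by exact HY; field.
Qed.

Lemma Rpower_le_compat (a b p q : R) : 1 <= a <= b -> 0 <= p <= q -> Rpower a p <= Rpower b q.
Proof.
intros Ha Hp; unfold Rpower; apply exp_le_compat.
assert (0 <= ln a) by (rewrite <- ln_1; apply ln_le; lra).
assert (ln a <= ln b) by (apply ln_le; lra).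
nra.
Qed.

(** One bound serves both half-strips: decay is slowest for [mu], whereas 2 / cos((pi/2) sin d) is
    at least 1, so its power is largest for [nu]. In [y] the worst case is the edge |y| = d. *)
Lemma abs_E1_psiC_strip_le (d g mu nu x y : R) : 0 < d < PI / 2 -> 0 < mu -> mu <= g <= nu ->
  Rabs y <= d ->
  abs_E1 g (psiC (x, y))
  <= Rpower 2 nu / Rpower (cos (PI / 2 * sin d)) nu
     * exp (- (mu * (PI / 2 * cos d)) * Rabs (sinh x)).
Proof.
intros Hd Hmu Hg Hy; pose proof PI_RGT_0 as HPI.
assert (Hyd := proj1 (Rabs_le_between _ _) Hy).
assert (Hcd : 0 < cos d) by (apply cos_gt_0; lra).
assert (Hq := cos_half_PI_sin_gt_0 d ltac:(rewrite Rabs_pos_eq; lra)).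
assert (Hcosy : cos d <= cos y).
{ assert (E : cos y = cos (Rabs y)) by (unfold Rabs; destruct Rcase_abs; [rewrite cos_neg |]; reflexivity).
  rewrite E; apply cos_decr_1; try lra; apply Rabs_pos. }
assert (Hcs : cos (PI / 2 * sin d) <= cos (PI / 2 * sin y)).
{ assert (Hsd : 0 <= sin d <= 1) by (split; [apply sin_ge_0; lra | apply SIN_bound]).
  assert (H1 : sin y <= sin d) by (apply sin_incr_1; lra).
  assert (H2 : - sin d <= sin y) by (rewrite <- sin_neg; apply sin_incr_1; lra).
  set (t := PI / 2 * sin y).
  assert (E : cos t = cos (Rabs t)) by (unfold Rabs; destruct Rcase_abs; [rewrite cos_neg |]; reflexivity).
  assert (Ht : Rabs t <= PI / 2 * sin d) by (apply Rabs_le; unfold t; nra).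
  rewrite E; apply cos_decr_1; try apply Rabs_pos; nra. }
pose proof (COS_bound (PI / 2 * sin y)) as Hc1.
eapply Rle_trans; [apply abs_E1_psiC_le; lra |].
rewrite Rmult_comm; apply Rmult_le_compat; try (left; apply exp_pos).
- replace (Rpower 2 nu / Rpower (cos (PI / 2 * sin d)) nu)
    with (Rpower (2 / cos (PI / 2 * sin d)) nu).
  2: { unfold Rpower, Rdiv; rewrite <- exp_Ropp, <- exp_plus; f_equal.
    rewrite ln_mult, ln_Rinv by (try apply Rinv_0_lt_compat; lra); ring. }
  apply Rpower_le_compat; [split | lra].
  + apply Rle_div_r; lra.
  + unfold Rdiv; apply Rmult_le_compat_l; [lra |]; apply Rinv_le_contravar; assumption.
- apply exp_le_compat; pose proof (Rabs_pos (sinh x)).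
  rewrite <- !Ropp_mult_distr_l; apply Ropp_le_contravar, Rmult_le_compat_r; [lra |].
  apply Rmult_le_compat; [lra | apply Rmult_le_pos; lra | lra |].
  apply Rmult_le_compat_l; lra.
Qed.

(** * Truncation and the final constants *)

Ltac prove_pos := first
  [ lra
  | apply exp_pos
  | apply Rmult_lt_0_compat; prove_pos
  | apply Rinv_0_lt_compat; prove_pos
  | apply Rmult_le_pos; prove_pos
  | left; prove_pos ].

Lemma cosh_le_compat (x y : R) : 0 <= x <= y -> cosh x <= cosh y.
Proof.
intros H; apply sqr_le_inv; [pose proof (cosh_ge_1 y); lra |].
rewrite !cosh_sqr; apply Rplus_le_compat_l, pow_incr; split; [apply sinh_ge_0 | apply sinh_le]; lra.
Qed.

Lemma sinh_plus_ge (t h : R) : 0 <= t -> 0 <= h -> sinh t + h * cosh t <= sinh (t + h).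
Proof.
intros Ht Hh.
replace (sinh (t + h)) with (sinh t * cosh h + cosh t * sinh h).
2: { unfold sinh, cosh; rewrite Ropp_plus_distr, !exp_plus; field. }
pose proof (sinh_ge_0 t Ht); pose proof (cosh_ge_1 h); pose proof (cosh_ge_1 t).
pose proof (sinh_ge_id h Hh); nra.
Qed.

(** Discrete counterpart of the weight cosh u: with delta = c (sinh(t + h) - sinh t), the drop of
    exp(- c sinh) over one step is its final value times e^delta - 1 >= delta, and delta >= c h cosh
    X. *)
Lemma double_exp_tail_step (c h X t : R) : 0 < c -> 0 < h -> 0 <= X <= t ->
  exp (- c * sinh (t + h))
  <= (exp (- c * sinh t) - exp (- c * sinh (t + h))) / (c * h * cosh X).
Proof.
intros Hc Hh Ht.
assert (HX : 0 < c * h * cosh X)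
  by (pose proof (cosh_ge_1 X); prove_pos).
apply Rle_div_r; [exact HX |].
pose proof (sinh_plus_ge t h ltac:(lra) ltac:(lra)) as H1.
pose proof (cosh_le_compat X t Ht) as H2.
set (e := exp (- c * sinh (t + h))).
assert (He : 0 < e) by apply exp_pos.
replace (exp (- c * sinh t)) with (e * exp (c * (sinh (t + h) - sinh t)))
  by (unfold e; rewrite <- exp_plus; f_equal; ring).
pose proof (exp_ineq1_le (c * (sinh (t + h) - sinh t))) as H3.
assert (H4 : c * h * cosh X <= c * (sinh (t + h) - sinh t)).
{ rewrite Rmult_assoc; apply Rmult_le_compat_l; [lra |].
  apply Rle_trans with (h * cosh t); [apply Rmult_le_compat_l; lra | lra]. }
nra.
Qed.

Lemma Rabs_sinc_le_1 (k : Z) (h x : R) : Rabs (sinc k h x) <= 1.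
Proof.
unfold sinc; destruct Req_EM_T; [rewrite Rabs_R1; lra |].
set (t := PI * (x / h - IZR k)).
destruct (Req_dec t 0) as [-> | Ht].
- unfold Rdiv; rewrite sin_0, Rmult_0_l, Rabs_R0; lra.
- rewrite Rabs_div by exact Ht; apply Rle_div_l; [apply Rabs_pos_lt, Ht |].
  rewrite Rmult_1_l; apply Rabs_sin_le.
Qed.

Lemma right_tail (F : C -> C) (c h q x : R) (N L : Z) : 0 < c -> 0 < h -> 0 <= q ->
  (0 <= N <= L)%Z ->
  (forall t, 0 <= t -> Cmod (F (RtoC t)) <= q * exp (- c * Rabs (sinh t))) ->
  Cmod (sum_Z (N + 1) L (fun k => F (RtoC (IZR k * h)) * RtoC (sinc k h x)))%C
  <= q * exp (- c * sinh (IZR N * h)) / (c * h * cosh (IZR N * h)).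
Proof.
intros Hc Hh Hq HN HF.
set (D := c * h * cosh (IZR N * h)).
assert (HD : 0 < D).
{ unfold D; pose proof (cosh_ge_1 (IZR N * h)); prove_pos. }
assert (HN0 : 0 <= IZR N * h) by (apply Rmult_le_pos; [apply IZR_le; lia | lra]).
eapply Rle_trans.
- apply (Cmod_sum_Z_telescope _ _ _ (fun k => q * exp (- c * sinh (IZR k * h)) / D)); [lia |].
  intros k Hk; cbv beta.
  set (t := IZR (k - 1) * h).
  assert (Ht : IZR N * h <= t) by (apply Rmult_le_compat_r; [lra | apply IZR_le; lia]).
  replace (IZR k * h) with (t + h) by (unfold t; rewrite minus_IZR; ring).
  rewrite Cmod_mult, Cmod_R; apply Rle_trans with (q * exp (- c * sinh (t + h)) * 1).
  + apply Rmult_le_compat; [apply Cmod_ge_0 | apply Rabs_pos | | apply Rabs_sinc_le_1].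
    eapply Rle_trans; [apply HF; lra |].
    rewrite (Rabs_pos_eq (sinh (t + h))) by (apply sinh_ge_0; lra); lra.
  + pose proof (double_exp_tail_step c h (IZR N * h) t Hc Hh ltac:(lra)) as H; fold D in H.
    apply (Rmult_le_compat_l q) in H; [| exact Hq].
    replace (q * exp (- c * sinh t) / D - q * exp (- c * sinh (t + h)) / D)
      with (q * ((exp (- c * sinh t) - exp (- c * sinh (t + h))) / D)) by (field; lra).
    lra.
- cbv beta; replace (N + 1 - 1)%Z with N by lia.
  assert (0 <= q * exp (- c * sinh (IZR L * h)) / D); [| lra].
  apply Rle_mult_inv_pos; [apply Rmult_le_pos; [exact Hq | left; apply exp_pos] | exact HD].
Qed.

Lemma left_tail (F : C -> C) (c h q x : R) (M L : Z) : 0 < c -> 0 < h -> 0 <= q ->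
  (0 <= M <= L)%Z ->
  (forall t, t < 0 -> Cmod (F (RtoC t)) <= q * exp (- c * Rabs (sinh t))) ->
  Cmod (sum_Z (- L) (- M - 1) (fun k => F (RtoC (IZR k * h)) * RtoC (sinc k h x)))%C
  <= q * exp (- c * sinh (IZR M * h)) / (c * h * cosh (IZR M * h)).
Proof.
intros Hc Hh Hq HM HF.
set (D := c * h * cosh (IZR M * h)).
assert (HD : 0 < D).
{ unfold D; pose proof (cosh_ge_1 (IZR M * h)); prove_pos. }
assert (HM0 : 0 <= IZR M * h) by (apply Rmult_le_pos; [apply IZR_le; lia | lra]).
eapply Rle_trans.
(* The terms increase with [k], so the telescoping function is negated and reflected. The shift by 1
   makes its value at the last index - M - 1 the exponential at M h. *)
- apply (Cmod_sum_Z_telescope _ _ _ (fun k => - (q * exp (- c * sinh (IZR (- k - 1) * h)) / D))); [lia |].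
  intros k Hk; cbv beta.
  set (t := IZR (- k - 1) * h).
  assert (Ht : IZR M * h <= t) by (apply Rmult_le_compat_r; [lra | apply IZR_le; lia]).
  replace (IZR (- (k - 1) - 1) * h) with (t + h)
    by (unfold t; rewrite !minus_IZR, !opp_IZR, minus_IZR; ring).
  replace (IZR k * h) with (- (t + h)) by (unfold t; rewrite minus_IZR, opp_IZR; ring).
  rewrite Cmod_mult, Cmod_R; apply Rle_trans with (q * exp (- c * sinh (t + h)) * 1).
  + apply Rmult_le_compat; [apply Cmod_ge_0 | apply Rabs_pos | | apply Rabs_sinc_le_1].
    eapply Rle_trans; [apply HF; lra |].
    rewrite sinh_opp, Rabs_Ropp, (Rabs_pos_eq (sinh (t + h))) by (apply sinh_ge_0; lra); lra.
  + pose proof (double_exp_tail_step c h (IZR M * h) t Hc Hh ltac:(lra)) as H; fold D in H.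
    apply (Rmult_le_compat_l q) in H; [| exact Hq].
    replace (- (q * exp (- c * sinh (t + h)) / D) - - (q * exp (- c * sinh t) / D))
      with (q * ((exp (- c * sinh t) - exp (- c * sinh (t + h))) / D)) by (field; lra).
    lra.
- cbv beta; replace (- (- M - 1) - 1)%Z with M by lia.
  assert (0 <= q * exp (- c * sinh (IZR (- (- L - 1) - 1) * h)) / D); [| lra].
  apply Rle_mult_inv_pos; [apply Rmult_le_pos; [exact Hq | left; apply exp_pos] | exact HD].
Qed.

(** In - g (pi/2) sinh X the growing half gives - (pi/4) g e^X <= - pi w / 4, and the other half
    (pi/4) g e^(-X) is at most pi nu / 4: hence exp(pi nu / 4). The denominator uses cosh X >= e^X /
    2. *)
Lemma tail_value_le (g nu h K X w : R) : 0 < g <= nu -> 0 < h -> 0 < K -> 0 <= X -> 0 < w ->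
  w <= g * exp X ->
  K * Rpower 2 g * exp (- (g * (PI / 2)) * sinh X) / (g * (PI / 2) * h * cosh X)
  <= K * Rpower 2 nu * exp (PI * nu / 4) * exp (- (PI * w / 4)) / (PI * (w / 4) * h).
Proof.
intros Hg Hh HK HX Hw HgX; pose proof PI_RGT_0 as HPI.
assert (He : exp (- X) <= 1) by (rewrite <- exp_0; apply exp_le_compat; lra).
assert (HeX := exp_pos X); assert (HemX := exp_pos (- X)).
unfold Rdiv at 1 6; apply Rmult_le_compat.
- prove_pos.
- left; apply Rinv_0_lt_compat; pose proof (cosh_ge_1 X).
  prove_pos.
- rewrite !Rmult_assoc; apply Rmult_le_compat_l; [lra |].
  apply Rmult_le_compat; try (left; apply exp_pos).
  + apply Rpower_le_compat; lra.
  + rewrite <- exp_plus; apply exp_le_compat; unfold sinh.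
    assert (H1 : g * exp (- X) <= nu) by nra.
    apply (Rmult_le_compat_l PI) in H1, HgX; lra.
- apply Rinv_le_contravar; [prove_pos |].
  unfold cosh; assert (w / 4 <= g * (exp X / 4)) by lra.
  assert (0 <= g * exp (- X)) by (apply Rmult_le_pos; lra).
  apply Rle_trans with (PI * (g * ((exp X + exp (- X)) / 4)) * h); [| right; field].
  apply Rmult_le_compat_r; [lra |]; apply Rmult_le_compat_l; lra.
Qed.

(** * Passage to the limit and assembly of the constants *)

Lemma le_left_limit (f : R -> R) (d y : R) : continuity_pt f d -> 0 < d ->
  (forall s, 0 < s < d -> f s <= y) -> f d <= y.
Proof.
intros Hf Hd H; destruct (Rle_or_lt (f d) y) as [L | L]; [exact L | exfalso].
destruct (Hf (f d - y) ltac:(lra)) as [a [Ha Hlim]].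
set (s := d - Rmin a d / 2).
assert (Hm : 0 < Rmin a d /\ Rmin a d <= a /\ Rmin a d <= d)
  by (unfold Rmin; destruct Rle_dec; lra).
assert (Hs : 0 < s < d) by (unfold s; lra).
specialize (H s Hs); specialize (Hlim s); simpl in Hlim; unfold Rdist in Hlim.
assert (Hlt : Rabs (f s - f d) < f d - y).
{ apply Hlim; split; [split; [exact I | lra] |].
  rewrite Rabs_left by lra; unfold s; lra. }
apply Rabs_lt_between in Hlt; lra.
Qed.

(** This is 1 + t <= e^t at t = ln z - 1, and the origin of the number e in 1 - exp(- pi mu e /
    2). *)
Lemma exp1_mul_ln_le (z : R) : 0 < z -> exp 1 * ln z <= z.
Proof.
intros Hz; pose proof (exp_ineq1_le (ln z - 1)) as H.
rewrite <- (exp_ln z) at 2 by exact Hz.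
replace (exp (ln z)) with (exp 1 * exp (ln z - 1)) by (rewrite <- exp_plus; f_equal; ring).
apply Rmult_le_compat_l; [left; apply exp_pos | lra].
Qed.

Lemma le_of_forall_eps (x y : R) : (forall eps, 0 < eps -> x <= y + eps) -> x <= y.
Proof.
intros H; destruct (Rle_or_lt x y) as [L | L]; [exact L |].
specialize (H ((x - y) / 2) ltac:(lra)); lra.
Qed.

(** With [decay_const], the values of [k] and [B] to which the sinc expansion is applied; they
    depend on [d] and not on [s]. *)
Definition decay_rate (d mu : R) : R := mu * (PI / 2 * cos d).
Definition decay_const (d K nu : R) : R := K * (Rpower 2 nu / Rpower (cos (PI / 2 * sin d)) nu).

Lemma lift_decay (d : R) (F : C -> C) (K alpha beta u v : R) :
  0 < d < PI / 2 -> 0 < K -> 0 < alpha -> 0 < beta ->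
  (forall zeta : C, strip_minus d zeta -> Cmod (F zeta) <= K * abs_E1 alpha (psiC zeta)) ->
  (forall zeta : C, strip_plus d zeta -> Cmod (F zeta) <= K * abs_E1 beta (psiC zeta)) ->
  Rabs v < d ->
  Cmod (F (u, v)) <= decay_const d K (Rmax alpha beta)
                     * exp (- decay_rate d (Rmin alpha beta) * Rabs (sinh u)).
Proof.
intros Hd HK Ha Hb Hm Hp Hv; unfold decay_const, decay_rate; rewrite Rmult_assoc.
assert (Hmin : 0 < Rmin alpha beta) by (apply Rmin_glb_lt; assumption).
destruct (Rlt_or_le u 0) as [Hu | Hu].
- eapply Rle_trans; [apply Hm; split; [exact Hv | exact Hu] |].
  apply Rmult_le_compat_l; [lra |]; apply abs_E1_psiC_strip_le; try lra.
  split; [apply Rmin_l | apply Rmax_l].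
- eapply Rle_trans; [apply Hp; split; [exact Hv | exact Hu] |].
  apply Rmult_le_compat_l; [lra |]; apply abs_E1_psiC_strip_le; try lra.
  split; [apply Rmin_r | apply Rmax_r].
Qed.

(** On the real line both trigonometric factors are 1. The tails thus keep their own exponent
    [alpha] or [beta], to which [M] and [N] are adapted. *)
Lemma abs_E1_psiC_real_le (g t : R) : 0 < g ->
  abs_E1 g (psiC (RtoC t)) <= Rpower 2 g * exp (- (g * (PI / 2)) * Rabs (sinh t)).
Proof.
intros Hg; eapply Rle_trans; [apply abs_E1_psiC_le; [exact Hg |] |].
- rewrite Rabs_R0; pose proof PI_RGT_0; lra.
- rewrite cos_0, sin_0, Rmult_0_r, cos_0, Rmult_1_r, Rdiv_1_r, Rmult_comm; lra.
Qed.

Lemma truncated_sinc_error (d : R) (F : C -> C) (K alpha beta h w x : R) (M N : Z) :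
  0 < d < PI / 2 -> analytic_on (strip d) F -> 0 < K -> 0 < alpha -> 0 < beta ->
  (forall zeta : C, strip_minus d zeta -> Cmod (F zeta) <= K * abs_E1 alpha (psiC zeta)) ->
  (forall zeta : C, strip_plus d zeta -> Cmod (F zeta) <= K * abs_E1 beta (psiC zeta)) ->
  let mu := Rmin alpha beta in let nu := Rmax alpha beta in
  0 < h -> 0 < w -> (0 <= M)%Z -> (0 <= N)%Z ->
  w <= alpha * exp (IZR M * h) -> w <= beta * exp (IZR N * h) ->
  Cmod (F (RtoC x) - sum_Z (- M) N (fun k => F (RtoC (IZR k * h)) * RtoC (sinc k h x)))%C
  <= 2 * decay_const d K nu / (PI * decay_rate d mu * d * sinh (PI / h * d))
     + 2 * (K * Rpower 2 nu * exp (PI * nu / 4) * exp (- (PI * w / 4)) / (PI * (w / 4) * h)).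
Proof.
intros Hd HF HK Ha Hb Hm Hp mu nu Hh Hw HM HN HwM HwN.
pose proof PI_RGT_0 as HPI.
set (B := decay_const d K nu); set (k := decay_rate d mu).
set (T := K * Rpower 2 nu * exp (PI * nu / 4) * exp (- (PI * w / 4)) / (PI * (w / 4) * h)).
set (g := fun i => (F (RtoC (IZR i * h)) * RtoC (sinc i h x))%C).
set (E := Cmod (F (RtoC x) - sum_Z (- M) N g)%C).
assert (HB : 0 <= B).
{ unfold B, decay_const; apply Rmult_le_pos; [lra |].
  apply Rle_mult_inv_pos; [left |]; apply exp_pos. }
assert (Hk : 0 < k).
{ unfold k, decay_rate; assert (0 < cos d) by (apply cos_gt_0; lra).
  assert (0 < mu) by (apply Rmin_glb_lt; assumption).
  prove_pos. }
(* The tails are bounded uniformly in [L], so [L] can be chosen afterwards, depending on [x] and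
   [eps]. *)
assert (Htails : forall L, (M <= L)%Z -> (N <= L)%Z ->
  E <= Cmod (F (RtoC x) - sum_Z (- L) L g)%C + 2 * T).
{ intros L HML HNL.
  assert (HR : Cmod (sum_Z (N + 1) L g) <= T).
  { eapply Rle_trans; [apply (right_tail F (beta * (PI / 2)) h (K * Rpower 2 beta) x N L) |].
    - apply Rmult_lt_0_compat; lra.
    - exact Hh.
    - apply Rmult_le_pos; [lra | left; apply exp_pos].
    - lia.
    - intros t Ht; eapply Rle_trans; [apply Hp; split; [| exact Ht] |].
      + unfold strip, Im, RtoC; simpl; rewrite Rabs_R0; lra.
      + rewrite Rmult_assoc; apply Rmult_le_compat_l; [lra | apply abs_E1_psiC_real_le, Hb].
    - apply tail_value_le; try assumption; [split; [exact Hb | apply Rmax_r] |].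
      apply Rmult_le_pos; [apply IZR_le, HN | lra]. }
  assert (HL : Cmod (sum_Z (- L) (- M - 1) g) <= T).
  { eapply Rle_trans; [apply (left_tail F (alpha * (PI / 2)) h (K * Rpower 2 alpha) x M L) |].
    - apply Rmult_lt_0_compat; lra.
    - exact Hh.
    - apply Rmult_le_pos; [lra | left; apply exp_pos].
    - lia.
    - intros t Ht; eapply Rle_trans; [apply Hm; split; [| exact Ht] |].
      + unfold strip, Im, RtoC; simpl; rewrite Rabs_R0; lra.
      + rewrite Rmult_assoc; apply Rmult_le_compat_l; [lra | apply abs_E1_psiC_real_le, Ha].
    - apply tail_value_le; try assumption; [split; [exact Ha | apply Rmax_l] |].
      apply Rmult_le_pos; [apply IZR_le, HM | lra]. }
  unfold E.
  replace (F (RtoC x) - sum_Z (- M) N g)%C with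
    ((F (RtoC x) - sum_Z (- L) L g) + (sum_Z (- L) (- M - 1) g + sum_Z (N + 1) L g))%C.
  - eapply Rle_trans; [apply Cmod_triangle |].
    pose proof (Cmod_triangle (sum_Z (- L) (- M - 1) g) (sum_Z (N + 1) L g)); lra.
  - rewrite (sum_Z_split (- L) (- M - 1) L) by lia.
    replace (- M - 1 + 1)%Z with (- M)%Z by lia.
    rewrite (sum_Z_split (- M) N L) by lia; ring. }
(* Cleared of denominators, the left side is continuous in [s] and the right side does not depend on
   it, as the limit [s] to [d] requires. *)
assert (Hs : forall s, 0 < s < d -> (E - 2 * T) * (s * sinh (PI / h * s)) <= 2 * B / (PI * k)).
{ intros s Hs.
  assert (Hsinh : 0 < sinh (PI / h * s))
    by (apply sinh_gt_0, Rmult_lt_0_compat; [apply Rdiv_lt_0_compat |]; lra).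
  apply Rle_div_r; [apply Rmult_lt_0_compat; lra |].
  replace (2 * B / (PI * k) / (s * sinh (PI / h * s)))
    with (2 * B / (PI * k * s * sinh (PI / h * s))) by (field; lra).
  apply le_of_forall_eps; intros eps Heps.
  assert (Hder : forall u v, - s <= v <= s -> Cderivable F (u, v)).
  { intros u v Hv; apply Cderivable_of_ex_derive, HF; unfold strip; simpl.
    apply Rabs_lt_between; lra. }
  assert (Hdec : forall u v, - s <= v <= s -> Cmod (F (u, v)) <= B * exp (- k * Rabs (sinh u))).
  { intros u v Hv; apply lift_decay; try assumption; apply Rabs_lt_between; lra. }
  destruct (sinc_series_error F h s B k Hh (proj1 Hs) HB Hk Hder Hdec x eps Heps) as [L0 HL0].
  pose proof (HL0 (Z.max L0 (Z.max M N)) ltac:(lia)) as H1.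
  pose proof (Htails (Z.max L0 (Z.max M N)) ltac:(lia) ltac:(lia)) as H2.
  unfold g in H2; lra. }
assert (Hlim : (E - 2 * T) * (d * sinh (PI / h * d)) <= 2 * B / (PI * k)).
{ apply (le_left_limit (fun s => (E - 2 * T) * (s * sinh (PI / h * s))) d); [| lra | exact Hs].
  unfold sinh; reg. }
assert (Hsinh : 0 < sinh (PI / h * d))
  by (apply sinh_gt_0, Rmult_lt_0_compat; [apply Rdiv_lt_0_compat |]; lra).
apply (Rle_div_r _ _ (d * sinh (PI / h * d))) in Hlim; [| apply Rmult_lt_0_compat; lra].
replace (2 * B / (PI * k) / (d * sinh (PI / h * d)))
  with (2 * B / (PI * k * d * sinh (PI / h * d))) in Hlim by (field; lra).
lra.
Qed.

(** Rounding down gives N h >= n h - ln(b / a), so b e^(N h) >= a e^(n h): the faster decaying side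
    reaches the level [w] with no more terms than the slower one. *)
Lemma truncation_index (a b h w : R) (n : nat) : 0 < a <= b -> 0 < h ->
  a * exp (INR n * h) = w -> ln (b / a) <= INR n * h ->
  let N := (Z.of_nat n - Zfloor (ln (b / a) / h))%Z in
  (0 <= N)%Z /\ w <= b * exp (IZR N * h).
Proof.
intros Ha Hh Hw Hn N.
pose proof (Zfloor_bound (ln (b / a) / h)) as [Hfl _].
assert (H1 : IZR (Zfloor (ln (b / a) / h)) * h <= ln (b / a)) by (apply Rle_div_r; assumption).
assert (HN : IZR N = INR n - IZR (Zfloor (ln (b / a) / h)))
  by (unfold N; rewrite minus_IZR, <- INR_IZR_INZ; reflexivity).
split.
- apply le_IZR; rewrite HN.
  assert (ln (b / a) / h <= INR n) by (apply Rle_div_l; assumption); lra.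
- rewrite <- Hw; apply Rle_trans with (b * exp (INR n * h - ln (b / a))).
  + unfold Rminus; rewrite exp_plus, exp_Ropp, exp_ln by (apply Rdiv_lt_0_compat; lra).
    right; field; lra.
  + apply Rmult_le_compat_l; [lra |]; apply exp_le_compat; rewrite HN; lra.
Qed.

(** With tau = pi d / h, the factor 1 - e^(-2 tau) of 2 sinh tau / e^tau is bounded below
    independently of [n]. In the tail term pi (w / 4) h = pi d l, and l >= 1 lets both this
    denominator and the exponent be weakened. *)
Lemma error_constants (d K mu nu h w : R) : 0 < d < PI / 2 -> 0 < K -> 0 < mu <= nu ->
  let l := ln (w / mu) in
  0 < h -> 0 < w -> 1 <= l -> h * w = 4 * d * l ->
  2 * decay_const d K nu / (PI * decay_rate d mu * d * sinh (PI / h * d))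
  + 2 * (K * Rpower 2 nu * exp (PI * nu / 4) * exp (- (PI * w / 4)) / (PI * (w / 4) * h))
  <= const_C1 K d mu nu * exp (- (PI * (w / 4) / l)).
Proof.
intros Hd HK Hmu l Hh Hw Hl Hhw; pose proof PI_RGT_0 as HPI.
assert (Hcd : 0 < cos d) by (apply cos_gt_0; lra).
set (tau := PI * (w / 4) / l).
assert (Htau : PI / h * d = tau).
{ unfold tau; replace h with (4 * d * l / w) by (rewrite <- Hhw; field; lra); field; lra. }
rewrite Htau; unfold decay_const, decay_rate, const_C1.
set (qn := Rpower (cos (PI / 2 * sin d)) nu).
assert (Hqn : 0 < qn) by apply exp_pos.
set (P2 := Rpower 2 nu); assert (HP2 : 0 < P2) by apply exp_pos.
replace (Rpower 2 (nu + 1)) with (2 * P2)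
  by (unfold P2; rewrite Rpower_plus, Rpower_1 by lra; ring).
set (rho := 1 - exp (- (PI * mu * exp 1 / 2))).
assert (Hrho : 0 < rho).
{ unfold rho; assert (exp (- (PI * mu * exp 1 / 2)) < 1); [| lra].
  assert (0 < PI * mu * exp 1) by prove_pos.
  rewrite <- exp_0 at 2; apply exp_increasing; lra. }
(* Here 2 tau = (pi mu / 2) z / ln z with z = w / mu, and z / ln z >= e. *)
assert (H2tau : PI * mu * exp 1 / 2 <= 2 * tau).
{ unfold tau; apply Rle_trans with (PI * mu / 2 * (w / mu / l)); [| right; field; lra].
  replace (PI * mu * exp 1 / 2) with (PI * mu / 2 * exp 1) by field.
  apply Rmult_le_compat_l; [apply Rle_mult_inv_pos; [apply Rmult_le_pos; lra | lra] |].
  apply Rle_div_r; [lra |]; apply exp1_mul_ln_le, Rdiv_lt_0_compat; lra. }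
assert (Hsinh : exp tau * rho / 2 <= sinh tau).
{ unfold sinh, rho; replace (exp (- tau)) with (exp tau * exp (- (2 * tau)))
    by (rewrite <- exp_plus; f_equal; ring).
  assert (exp (- (2 * tau)) <= exp (- (PI * mu * exp 1 / 2))) by (apply exp_le_compat; lra).
  pose proof (exp_pos tau); nra. }
assert (Het := exp_pos tau).
rewrite (exp_Ropp tau), Rmult_plus_distr_l, Rmult_plus_distr_r; apply Rplus_le_compat.
- apply Rle_trans with
    (2 * (K * (P2 / qn)) / (PI * (mu * (PI / 2 * cos d)) * d * (exp tau * rho / 2))).
  + apply Rmult_le_compat_l.
    * prove_pos.
    * apply Rinv_le_contravar.
      -- prove_pos.
      -- apply Rmult_le_compat_l; [| exact Hsinh].
         prove_pos.
  + right; field; repeat split; lra.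
- assert (Hexp : exp (- (PI * w / 4)) <= / exp tau).
  { rewrite <- exp_Ropp; apply exp_le_compat, Ropp_le_contravar; unfold tau.
    apply Rle_div_l; [lra |].
    assert (0 < PI * w / 4) by (apply Rdiv_lt_0_compat; [apply Rmult_lt_0_compat |]; lra); nra. }
  set (e4 := exp (PI * nu / 4)); assert (He4 : 0 < e4) by apply exp_pos.
  replace (PI * (w / 4) * h) with (PI * d * l) by (replace (PI * (w / 4) * h) with (PI * (h * w) / 4) by field; rewrite Hhw; field).
  apply Rle_trans with (2 * (K * P2 * e4 * / exp tau / (PI * d * 1))); [| right; field; lra].
  apply Rmult_le_compat_l; [lra |]; apply Rmult_le_compat.
  + prove_pos.
  + left; apply Rinv_0_lt_compat; prove_pos.
  + apply Rmult_le_compat_l; [prove_pos | exact Hexp].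
  + apply Rinv_le_contravar; [prove_pos |].
    apply Rmult_le_compat_l; [apply Rmult_le_pos; lra | exact Hl].
Qed.

Theorem theorem2p7 :
  forall (d : R) (F : C -> C) (K alpha beta : R),
  0 < d < PI / 2 ->
  analytic_on (strip d) F ->
  0 < K -> 0 < alpha -> 0 < beta ->
  (forall zeta : C, strip_minus d zeta -> Cmod (F zeta) <= K * abs_E1 alpha (psiC zeta)) ->
  (forall zeta : C, strip_plus d zeta -> Cmod (F zeta) <= K * abs_E1 beta (psiC zeta)) ->
  let f := on_real_line F in
  let mu := Rmin alpha beta in
  let nu := Rmax alpha beta in
  forall n : nat, (0 < n)%nat ->
  let h := ln (4 * d * INR n / mu) / INR n in
  forall M N : Z,
  (mu = alpha -> M = Z.of_nat n /\ N = (Z.of_nat n - Zfloor (ln (beta / alpha) / h))%Z) ->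
  (mu = beta -> N = Z.of_nat n /\ M = (Z.of_nat n - Zfloor (ln (alpha / beta) / h))%Z) ->
  nu * exp 1 / (4 * d) <= INR n ->
  Rbar_le
    (Lub_Rbar (fun y : R => exists t : R,
       y = Cmod (f t - sum_Z (- M) N
                   (fun k => f (psi (IZR k * h)) * RtoC (sinc k h (psi_inv t))))%C))
    (Finite (const_C1 K d mu nu * exp (- (PI * d * INR n / ln (4 * d * INR n / mu))))).
Proof.
intros d F K alpha beta Hd HF HK Ha Hb Hm Hp f mu nu n Hn h M N HMN1 HMN2 Hlarge.
assert (Hn0 : 0 < INR n) by (apply lt_0_INR, Hn).
assert (Hmu : 0 < mu) by (apply Rmin_glb_lt; assumption).
assert (Hmunu : mu <= nu) by (eapply Rle_trans; [apply Rmin_l | apply Rmax_l]).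
set (w := 4 * d * INR n) in *.
assert (Hw : 0 < w) by (unfold w; prove_pos).
assert (Hwnu : nu * exp 1 <= w) by (apply Rle_div_l in Hlarge; unfold w; lra).
set (l := ln (w / mu)) in *.
assert (Hnumu : 1 <= nu / mu) by (apply Rle_div_r; lra).
(* The size condition on [n] says w >= nu e. This yields both l >= 1, needed for the constants, and
   ln(nu / mu) <= l = n h, needed for nonnegative truncation indices. *)
assert (Hl : 1 + ln (nu / mu) <= l).
{ unfold l; replace (1 + ln (nu / mu)) with (ln (exp 1 * (nu / mu)))
    by (rewrite ln_mult, ln_exp by (try apply exp_pos; lra); reflexivity).
  apply ln_le; [apply Rmult_lt_0_compat; [apply exp_pos | lra] |].
  apply (Rle_div_r _ _ mu); [lra |].
  apply Rle_trans with (nu * exp 1); [right; field; lra | exact Hwnu]. }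
assert (Hln : 0 <= ln (nu / mu)) by (rewrite <- ln_1; apply ln_le; lra).
assert (Hh : 0 < h) by (apply Rdiv_lt_0_compat; lra).
assert (Hnh : INR n * h = l) by (unfold h; field; lra).
assert (Hexp : mu * exp (INR n * h) = w).
{ rewrite Hnh; unfold l; rewrite exp_ln by (apply Rdiv_lt_0_compat; lra); field; lra. }
assert (Hidx : (0 <= M)%Z /\ (0 <= N)%Z /\ w <= alpha * exp (IZR M * h) /\ w <= beta * exp (IZR N * h)).
(* If [alpha = beta], both descriptions of [M] and [N] apply and the first is used. *)
{ unfold mu, nu in *; destruct (Rle_or_lt alpha beta) as [L | L].
  - rewrite Rmin_left, Rmax_right in * by lra.
    destruct (HMN1 eq_refl) as [-> ->].
    destruct (truncation_index alpha beta h w n ltac:(lra) Hh Hexp ltac:(lra)) as [H1 H2].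
    rewrite <- INR_IZR_INZ; repeat split; [lia | exact H1 | lra | exact H2].
  - rewrite Rmin_right, Rmax_left in * by lra.
    destruct (HMN2 eq_refl) as [-> ->].
    destruct (truncation_index beta alpha h w n ltac:(lra) Hh Hexp ltac:(lra)) as [H1 H2].
    rewrite <- INR_IZR_INZ; repeat split; [exact H1 | lia | exact H2 | lra]. }
destruct Hidx as [HM [HN [HwM HwN]]].
apply (proj2 (Lub_Rbar_correct _)); intros y [t ->].
simpl; unfold f, on_real_line.
(* The sample f(psi(k h)) is the lift at k h because [psi_inv] inverts [psi] on the real line, so
   only [F] on the strip remains. *)
rewrite (sum_Z_ext (- M) N _
  (fun k => F (RtoC (IZR k * h)) * RtoC (sinc k h (psi_inv t)))%C) by
  (lia || (intros k _; rewrite psi_inv_psi; reflexivity)).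
eapply Rle_trans.
- apply (truncated_sinc_error d F K alpha beta h w); assumption.
- replace (PI * d * INR n) with (PI * (w / 4)) by (unfold w; field).
  apply (error_constants d K mu nu h w); try assumption; fold l; try lra.
  rewrite <- Hnh; unfold w; ring.
Qed.
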